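(* For $n\geq 1$ let $x_{n,1}<x_{n,2}<\dots<x_{n,n}=0$ be the $n$ (real, distinct) roots of the Eulerian polynomial $A_n(x)=\sum_{k=1}^n A(n,k)x^k$, and let $$\mu_n=\frac{1}{n}\sum_{k=1}^n \delta_{-x_{n,k}}.$$ Then, as $n\to\infty$, the sequence of probability measures $\mu_n$ converges weakly to a probability measure $\mu$ with support $[0,\infty)$. This measure $\mu$ is the distribution of $\exp(\pi Z)$, where $Z$ is a standard Cauchy random variable; equivalently, $\mu$ has density $$\frac{1}{t\left(\log^2 t+\pi^2\right)}\,1_{t>0}.$$
   Context: For $1\leq k\leq n$, $A(n,k)$ denotes the Eulerian number, i.e. the number of permutations of $\{1,\dots,n\}$ with exactly $k-1$ descents. It is a classical fact that $A_n(x)=\sum_{k=1}^n A(n,k)x^k$ has $n$ distinct real roots, all nonpositive, the largest being $0$. $\delta_a$ denotes the Dirac mass at $a$. *)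

(* Defs.v *)
From HB Require Import structures.
From mathcomp Require Import all_boot all_order all_algebra all_fingroup.
From mathcomp Require Import all_classical all_reals all_analysis.
From mathcomp Require Import measurable_realfun.

Set Implicit Arguments.
Unset Strict Implicit.
Unset Printing Implicit Defensive.

Import Order.TTheory GRing.Theory Num.Theory.
Import numFieldNormedType.Exports.

Local Open Scope classical_set_scope.
Local Open Scope ring_scope.

Definition descents (n : nat) (s : 'S_n) : {set 'I_n} :=
  [set i : 'I_n | [exists j : 'I_n, (j == i.+1 :> nat) && (s j < s i)%N]].

(* [k] is one more than the number of descents, so [eulerian_number n 0 = 0]. *)
Definition eulerian_number (n k : nat) : nat :=
  #|[set s : 'S_n | #|descents s|.+1 == k]%SET|.

Definition eulerian_poly (R : realType) (n : nat) : {poly R} :=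
  \sum_(1 <= k < n.+1) (eulerian_number n k)%:R *: 'X^k.

(* [y 1], ..., [y n] are the roots of the n-th Eulerian polynomial, listed in
   increasing order (for 1 <= n); the other values of [y] are irrelevant. *)
Record eulerian_roots (R : realType) (n : nat) (y : nat -> R) : Prop :=
  EulerianRoots {
    eulerian_roots_incr : forall j k : nat,
      (1 <= j)%N -> (j < k)%N -> (k <= n)%N -> y j < y k ;
    eulerian_rootsP : forall z : R,
      root (eulerian_poly R n) z <-> exists2 k : nat, (1 <= k <= n)%N & z = y k ;
    eulerian_roots_max : y n = 0
  }.

(* [msum _ n] sums over 0 <= k < n, hence the shift to [y 1], ..., [y n]. *)
Definition root_measure (R : realType) (y : nat -> R) (n : nat) :
    set R -> \bar R :=
  mscale (n%:R^-1)%:nng (msum (fun k : nat => dirac (- y k.+1)) n).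

HB.instance Definition _ (R : realType) (y : nat -> R) (n : nat) :=
  Measure.on (@root_measure R y n).

Lemma root_measure_setT (R : realType) (y : nat -> R) (n : nat) :
  @root_measure R y n.+1 setT = 1%E.
Proof.
rewrite /root_measure /mscale /= /msum.
rewrite (eq_bigr (fun=> 1%:E)) => [|k _]; last exact: diracT.
by rewrite sumEFin -EFinM sumr_const card_ord mulVf// pnatr_eq0.
Qed.

HB.instance Definition _ (R : realType) (y : nat -> R) (n : nat) :=
  Measure_isProbability.Build _ _ _ (@root_measure R y n.+1)
    (@root_measure_setT R y n).

Definition weakly_converges (R : realType)
    (mu_ : nat -> probability R R) (mu : probability R R) : Prop :=
  forall f : R -> R, continuous f -> (exists M : R, forall t, `|f t| <= M) ->
    (\int[mu_ n]_t (f t)%:E)%E @[n --> \oo] --> (\int[mu]_t (f t)%:E)%E.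

Definition measure_support (R : realType) (mu : probability R R) : set R :=
  [set t | forall U : set R, open U -> U t -> (0 < mu U)%E].

Definition has_density (R : realType) (mu : probability R R) (f : R -> R) :
    Prop :=
  [/\ measurable_fun setT f, forall t, 0 <= f t &
      forall A : set R, measurable A ->
        mu A = (\int[@lebesgue_measure R]_(t in A) (f t)%:E)%E].

Definition standard_cauchy_pdf (R : realType) (t : R) : R :=
  (pi * (1 + t ^+ 2))^-1.

Definition exp_pi (d : measure_display) (T : measurableType d) (R : realType)
    (Z : T -> R) : T -> R :=
  fun w => expR (pi * Z w).

Lemma measurable_exp_pi (d : measure_display) (T : measurableType d)
  (R : realType) (Z : {mfun T >-> R}) : measurable_fun setT (exp_pi Z).
Proof.
by apply: measurableT_comp => //; exact: measurable_funM.
Qed.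

HB.instance Definition _ (d : measure_display) (T : measurableType d)
    (R : realType) (Z : {mfun T >-> R}) :=
  isMeasurableFun.Build _ _ _ _ (exp_pi Z) (measurable_exp_pi Z).

(* Main.v *)
(* [f_n(x) = A_n(x) / (1 - x)^(n+1)] is [(x d/dx)^n] applied to [1 / (1 - x)], so
   at [x = - e^u] it is the n-th derivative of [1 / (1 + e^u)], a sum of
   [(-1)^(n+1) n! (u + i pi (2m+1))^-(n+1)] over the poles.  That expansion is
   obtained here as the limit [N -> oo] of a finite identity: the decomposition of
   [f_n(- x^N)] over the N-th roots of -1.  The two poles nearest to the real line
   dominate, and if [u / pi] is the [p]-quantile of the Cauchy law, then
   [- (u + i pi) = (pi / sin (pi p)) e^(- i pi p)].  Hence [A_n(- e^u)] has the sign
   [(-1)^j] at [p = j / (n+1)], which yields enough roots between the quantiles of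
   [exp (pi Z)] to bound the masses of intervals from below in the limit; the total
   mass being 1, there is no room for more. *)

Require Import Defs.
From HB Require Import structures.
From mathcomp Require Import all_boot all_order all_algebra all_fingroup.
From mathcomp Require Import all_classical all_reals all_analysis.
From mathcomp Require Import measurable_realfun complex ring lra zify.

Set Implicit Arguments.
Unset Strict Implicit.
Unset Printing Implicit Defensive.

Import Order.TTheory GRing.Theory Num.Theory.
Import numFieldNormedType.Exports.

Local Open Scope ring_scope.

(** * Eulerian polynomials and descents *)

Fixpoint eulerian_rec (R : nzRingType) (n : nat) : {poly R} :=
  if n is m.+1 then
    'X * (1 - 'X) * (eulerian_rec R m)^`() + m.+1%:R *: ('X * eulerian_rec R m)
  else 1.

Lemma lift_perm_pair_bij n (j0 : 'I_n.+1) :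
  bijective (fun p : 'I_n.+1 * 'S_n => lift_perm p.1 j0 p.2).
Proof.
apply: inj_card_bij; last by rewrite card_prod !card_Sn card_ord factS.
move=> [i s] [j t] /= E; have ij : i = j.
  by apply: (@perm_inj _ (lift_perm i j0 s)); rewrite lift_perm_id E lift_perm_id.
rewrite -ij in E *; congr pair; apply/permP => k; apply: (@lift_inj _ j0).
by rewrite -!(lift_perm_lift i) E.
Qed.

Lemma sum_perm_lift (V : nmodType) n (j0 : 'I_n.+1) (F : 'S_n.+1 -> V) :
  \sum_s F s = \sum_i \sum_(t : 'S_n) F (lift_perm i j0 t).
Proof. by rewrite pair_bigA (reindex _ (onW_bij _ (lift_perm_pair_bij j0))). Qed.

Lemma card_ord_lift n (i : 'I_n) (A : {set 'I_n}) :
  #|A| = ((i \in A) + \sum_(k < n.-1) (lift i k \in A))%N.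
Proof. by rewrite -sum1_card big_mkcond (bigD1_ord i) //=; congr (_ + _)%N; case: (_ \in _). Qed.

Lemma ord_max_notin_descents n (s : 'S_n.+1) : ord_max \notin descents s.
Proof.
rewrite inE; apply/existsP => -[j /andP[/eqP jn _]].
by have := ltn_ord j; rewrite jn ltnn.
Qed.

Lemma card_descents_le n (s : 'S_n.+1) : (#|descents s| <= n)%N.
Proof.
have := max_card (mem (ord_max |: descents s)).
by rewrite cardsU1 ord_max_notin_descents card_ord.
Qed.

Lemma lift_perm_max_descent n (i : 'I_n.+1) (t : 'S_n) :
  (i \in descents (lift_perm i ord_max t)) = (i != ord_max).
Proof.
have [-> | i_max] := eqVneq i ord_max; first exact/negbTE/ord_max_notin_descents.
have i_lt : (i.+1 < n.+1)%N.
  by rewrite ltnS ltn_neqAle -ltnS ltn_ord andbT -[n]/(val (@ord_max n)) val_eqE.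
rewrite inE; apply/existsP; exists (Ordinal i_lt); rewrite eqxx /= lift_perm_id.
case: (unliftP i (Ordinal i_lt)) => [k ->|/(congr1 val) /= i_eq].
  by rewrite lift_perm_lift lift_max ltn_ord.
by move: (ltnn i); rewrite -{2}i_eq ltnSn.
Qed.

(* The maximum inserted at position [i] turns position [i.-1] into an ascent. *)
Lemma lift_perm_lift_descent n (i : 'I_n.+1) (t : 'S_n) (k : 'I_n) :
  (lift i k \in descents (lift_perm i ord_max t)) =
  (k \in descents t) && (k.+1 != i :> nat).
Proof.
rewrite !inE; apply/existsP/andP => [[j]|[/existsP[j /andP[/eqP jk t_lt]] ki]].
  rewrite lift_perm_lift lift_max => /andP[/eqP j_lift].
  case: (unliftP i j) => [j'|] jE; last first.
    by rewrite jE lift_perm_id ltnNge ltnW //= ltn_ord.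
  rewrite jE lift_perm_lift lift_max => t_lt.
  have j'_bump : bump i j' = (bump i k).+1 by rewrite -[bump i j']/(val (lift i j')) -jE.
  have [j'k ki] : j' = k.+1 :> nat /\ k.+1 <> i.
    by move: j'_bump; rewrite /bump; case: (leqP i j'); case: (leqP i k) => /=; lia.
  by split; [apply/existsP; exists j'; rewrite t_lt andbT j'k | exact/eqP].
exists (lift i j); rewrite !lift_perm_lift !lift_max t_lt andbT /= /bump jk.
by apply/eqP; move/eqP: ki; case: (leqP i k); case: (leqP i k.+1) => /=; lia.
Qed.

Lemma card_descents_lift n (i : 'I_n.+1) (t : 'S_n) :
  #|descents (lift_perm i ord_max t)| =
  ((i != ord_max) + #|descents t :\: [set k : 'I_n | k.+1 == i :> nat]|)%N.
Proof.
rewrite (card_ord_lift i) lift_perm_max_descent; congr (_ + _)%N.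
rewrite -sum1_card [RHS]big_mkcond; apply: eq_bigr => k _.
by rewrite lift_perm_lift_descent !inE andbC; case: (_ && _).
Qed.

Lemma card_descents_lift0 n (t : 'S_n.+1) :
  #|descents (lift_perm ord0 ord_max t)| = #|descents t|.+1.
Proof.
rewrite card_descents_lift; congr (_.+1); apply: eq_card => k.
by rewrite !inE.
Qed.

Lemma card_descents_liftS n (t : 'S_n.+1) (k : 'I_n.+1) :
  #|descents (lift_perm (lift ord0 k) ord_max t)| =
  (#|descents t| + (k \notin ord_max |: descents t))%N.
Proof.
rewrite card_descents_lift in_setU1.
have -> : [set j : 'I_n.+1 | j.+1 == lift ord0 k :> nat] = [set k].
  by apply/finset.setP => j; rewrite !inE.
have -> : (lift ord0 k != ord_max) = (k != ord_max) by rewrite -!val_eqE.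
rewrite (cardsD1 k (descents t)); have [-> | _] := eqVneq k ord_max.
  by rewrite (negbTE (ord_max_notin_descents t)) addn0.
by case: (k \in descents t); rewrite ?addn0 // addnC.
Qed.

Lemma sum_descents_lift (R : comNzRingType) n (t : 'S_n.+1) :
  \sum_i 'X^(#|descents (lift_perm i ord_max t)|.+1) =
  'X * (1 - 'X) * ('X^(#|descents t|.+1))^`()
   + n.+2%:R *: ('X * 'X^(#|descents t|.+1)) :> {poly R}.
Proof.
set d := #|descents t|; set D := ord_max |: descents t.
have d_le : (d <= n)%N := card_descents_le t.
have D_card : #|D| = d.+1 by rewrite cardsU1 ord_max_notin_descents.
have DC_card : #|~: D| = (n - d)%N.
  by apply/eqP; rewrite -(eqn_add2l #|D|) cardsC D_card card_ord addSn subnKC.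
rewrite big_ord_recl card_descents_lift0 -/d (bigID (mem D)) /=.
rewrite (eq_bigr (fun=> 'X^(d.+1) : {poly R})) => [|k kD]; last first.
  by rewrite card_descents_liftS kD addn0.
rewrite [X in _ + (_ + X)](eq_bigr (fun=> 'X^(d.+2) : {poly R})) => [|k kD]; last first.
  by rewrite card_descents_liftS kD addn1.
rewrite !sumr_const D_card (eq_card (B := ~: D)) => [|k]; last by rewrite finset.in_setC.
rewrite DC_card derivXn /= scaler_nat -[in LHS]mulr_natl -['X^(d.+2) *+ _]mulr_natl.
rewrite -['X^d *+ _]mulr_natl -[_ *+ n.+2]mulr_natl natrB //.
by rewrite !exprS -!natr1; ring.
Qed.

Lemma eulerian_poly_sum (R : realType) n :
  eulerian_poly R n.+1 = \sum_(s : 'S_n.+1) 'X^(#|descents s|.+1).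
Proof.
rewrite /eulerian_poly.
rewrite [RHS](partition_big (fun s : 'S_n.+1 => inord #|descents s| : 'I_n.+1) xpredT) //=.
rewrite big_add1 /= big_mkord; apply: eq_bigr => k _.
rewrite (eq_bigr (fun=> 'X^(k.+1) : {poly R})); last first.
  by move=> s /eqP <-; rewrite inordK // ltnS card_descents_le.
rewrite sumr_const scaler_nat; congr (_ *+ _); apply: eq_card => s.
by rewrite inE eqSS [RHS]unfold_in /= inordK // ltnS card_descents_le.
Qed.

Lemma eulerian_rec_sum (R : comNzRingType) n :
  eulerian_rec R n.+1 = \sum_(s : 'S_n.+1) 'X^(#|descents s|.+1).
Proof.
elim: n => [|n IH].
  rewrite (eq_bigr (fun=> 'X : {poly R})) => [|s _]; last first.
    by have := card_descents_le s; rewrite leqn0 => /eqP ->.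
  by rewrite sumr_const card_Sn /= poly.derivE mulr0 add0r mulr1 scale1r.
rewrite [LHS]/= -/(eulerian_rec R n.+1) IH.
rewrite [RHS](sum_perm_lift ord_max) exchange_big /=.
under [RHS]eq_bigr do rewrite sum_descents_lift.
rewrite big_split /= -mulr_sumr; congr (_ * _ + _); first by rewrite linear_sum.
by rewrite -scaler_sumr -mulr_sumr.
Qed.

Lemma eulerian_polyE (R : realType) n : eulerian_poly R n.+1 = eulerian_rec R n.+1.
Proof. by rewrite eulerian_poly_sum eulerian_rec_sum. Qed.

Lemma map_eulerian_rec (R S : nzRingType) (f : {rmorphism R -> S}) n :
  map_poly f (eulerian_rec R n) = eulerian_rec S n.
Proof.
elim: n => [|n IH] /=; first by rewrite rmorph1.
rewrite rmorphD /= map_polyZ !rmorphM /= rmorphB rmorph1 /= !map_polyX.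
by rewrite -deriv_map IH rmorph_nat.
Qed.

Lemma horner_eulerian_rec1 (R : comNzRingType) n : (eulerian_rec R n).[1] = n`!%:R.
Proof.
elim: n => [|n IH] /=; first by rewrite hornerE.
by rewrite !(hornerE, hornerZ) /= IH subrr mul0r add0r mulr1 factS natrM.
Qed.

Lemma norm_horner_eulerian_rec (R : numFieldType) n (z c : R) :
  1 <= c -> `|z| ^+ n <= c -> `|(eulerian_rec R n).[z]| <= n`!%:R * c.
Proof.
move=> c1 zc; case: n zc => [|n] zc; first by rewrite /= hornerE normr1 mul1r.
rewrite eulerian_rec_sum horner_sum (le_trans (ler_norm_sum _ _ _)) //.
rewrite -card_Sn mulr_natl -sumr_const; apply: ler_sum => s _.
have s_le : (#|descents s|.+1 <= n.+1)%N by rewrite ltnS card_descents_le.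
rewrite hornerXn normrX; have [z1|/ltW z1] := real_leP (normr_real z) (@real1 R).
  by rewrite (le_trans _ c1) // exprn_ile1.
by rewrite (le_trans _ zc) // ler_weXn2l.
Qed.

(** * Multisection and partial fractions *)

Section multisection.
Variable R : comNzRingType.
Implicit Types (B L P Q : {poly R}).

(* The numerator of ['X * (B / Q ^+ n.+1)^`()] over [Q ^+ n.+2]. *)
Definition euler_op_num n Q B : {poly R} := Q * ('X * B^`()) - n.+1%:R * ('X * Q^`()) * B.

Lemma eulerian_recS n : eulerian_rec R n.+1 = euler_op_num n (1 - 'X) (eulerian_rec R n).
Proof. by rewrite /euler_op_num /= !poly.derivE scaler_nat -mulr_natl; ring. Qed.

Lemma euler_op_num_comp n Q B P (c : {poly R}) : 'X * P^`() = c * P ->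
  c * (euler_op_num n Q B \Po P) = euler_op_num n (Q \Po P) (B \Po P).
Proof.
move=> XP; rewrite /euler_op_num !deriv_comp.
rewrite comp_polyB !comp_polyM comp_polyX -[n.+1%:R]polyC_natr comp_polyC.
have X_deriv_comp x : 'X * (x * P^`()) = x * (c * P) by rewrite mulrCA XP.
by rewrite !X_deriv_comp; move: (_ \Po _) (_ \Po _) => b q; ring.
Qed.

Lemma euler_op_num_mul n Q L B :
  euler_op_num n (Q * L) (B * L ^+ n.+1) = euler_op_num n Q B * L ^+ n.+2.
Proof. by rewrite /euler_op_num !derivM deriv_exp /= -[_ *+ n.+1]mulr_natl !exprS; ring. Qed.

Lemma euler_op_num_natl n Q k B : euler_op_num n Q (k%:R * B) = k%:R * euler_op_num n Q B.
Proof.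
have deriv_natl : (k%:R * B)^`() = k%:R * B^`() by rewrite mulr_natl derivMn mulr_natl.
by rewrite /euler_op_num deriv_natl; ring.
Qed.

Lemma euler_op_num_sum (I : finType) n Q (B : I -> {poly R}) :
  euler_op_num n Q (\sum_i B i) = \sum_i euler_op_num n Q (B i).
Proof. by rewrite /euler_op_num raddf_sum !mulr_sumr -sumrB. Qed.

(* The identity is [N^(n+1) f_n(-x^N) = \sum_m f_n(eta_m x)] for
   [f_n(x) = E_n(x) / (1 - x)^(n+1) = (x d/dx)^n (1 / (1 - x))], cleared of
   denominators by means of [(1 - eta_m x) L_m = 1 + x^N]. *)
Lemma eulerian_rec_multisection (N n : nat) (eta : 'I_N -> R) :
  (0 < N)%N -> (forall m, eta m ^+ N = -1) ->
  (forall j, (0 < j < N)%N -> \sum_m eta m ^+ j = 0) ->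
  N%:R ^+ n.+1 * (eulerian_rec R n \Po (- 'X^N)) =
  \sum_m (eulerian_rec R n \Po (eta m *: 'X)) *
         (\sum_(j < N) (eta m *: 'X) ^+ j) ^+ n.+1.
Proof.
move=> N_gt0 eta_root eta_sum.
pose L m : {poly R} := \sum_(j < N) (eta m *: 'X) ^+ j.
have comp_mulL m : ((1 - 'X) \Po (eta m *: 'X)) * L m = 1 + 'X^N.
  have := subrX1 (eta m *: 'X : {poly R}) N; rewrite exprZn eta_root scaleN1r => geom.
  by rewrite comp_polyB comp_polyC comp_polyX -opprB mulNr -geom opprB opprK addrC.
elim: n => [|n IH].
  rewrite [RHS](eq_bigr L) => [|m _]; last by rewrite comp_polyC mul1r.
  rewrite comp_polyC /L exchange_big /= mulr1 expr1.
  rewrite (bigD1 (Ordinal N_gt0)) //= [X in _ = _ + X]big1 => [|j j0]; last first.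
    under eq_bigr do rewrite exprZn.
    by rewrite -scaler_suml eta_sum ?scale0r // ltn_ord andbT lt0n.
  by rewrite addr0 (eq_bigr (fun=> 1)) ?sumr_const ?card_ord.
have X_derivXN : 'X * (- 'X^N)^`() = N%:R * (- 'X^N) :> {poly R}.
  by rewrite derivN derivXn -mulr_natl !mulrN mulrCA -exprS prednK.
have X_derivZ m : 'X * (eta m *: 'X)^`() = 1 * (eta m *: 'X) :> {poly R}.
  by rewrite derivZ derivX alg_polyC mulrC mul1r mul_polyC.
rewrite eulerian_recS exprSr -mulrA (euler_op_num_comp _ _ _ X_derivXN) -natrX.
rewrite -euler_op_num_natl natrX IH comp_polyB comp_polyC comp_polyX opprK euler_op_num_sum.
apply: eq_bigr => m _; rewrite -/(L m) -(comp_mulL m) euler_op_num_mul.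
by rewrite -(euler_op_num_comp _ _ _ (X_derivZ m)) mul1r.
Qed.

End multisection.

Lemma eulerian_rec_partial_fractions (F : fieldType) (N n : nat) (eta : 'I_N -> F) (x : F) :
  N%:R != 0 :> F -> 1 + x ^+ N != 0 -> (forall m, eta m ^+ N = -1) ->
  (forall j, (0 < j < N)%N -> \sum_m eta m ^+ j = 0) ->
  (eulerian_rec F n).[- x ^+ N] / (1 + x ^+ N) ^+ n.+1 =
  \sum_m (eulerian_rec F n).[x * eta m] / (N%:R * (1 - x * eta m)) ^+ n.+1.
Proof.
move=> N_neq0 xN_neq0 eta_root eta_sum; have N_gt0 : (0 < N)%N.
  by rewrite lt0n; apply: contra_neq N_neq0 => ->.
have := congr1 (horner^~ x) (eulerian_rec_multisection n N_gt0 eta_root eta_sum).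
rewrite horner_sum hornerM -natrX -polyC_natr hornerC horner_comp hornerN hornerXn natrX.
move=> multisection; apply: (@mulfI _ (N%:R ^+ n.+1)); first by rewrite expf_neq0.
rewrite mulrA multisection mulr_suml mulr_sumr; apply: eq_bigr => m _.
rewrite hornerM horner_comp hornerZ hornerX [eta m * x]mulrC horner_exp horner_sum.
under eq_bigr do rewrite horner_exp hornerZ hornerX [eta m * x]mulrC.
set z := x * eta m; have geom : (1 - z) * (\sum_(j < N) z ^+ j) = 1 + x ^+ N.
  by rewrite -opprB mulNr -subrX1 /z exprMn eta_root mulrN1 opprB opprK addrC.
have := xN_neq0; rewrite -geom mulf_eq0 negb_or => /andP[z_neq1 geom_neq0].
rewrite !exprMn; move: (expf_neq0 n.+1 z_neq1) (expf_neq0 n.+1 geom_neq0).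
by move=> ? ?; field; do ?[apply/andP; split]; rewrite ?expf_neq0.
Qed.

Section cis.
Context {R : realType}.
Implicit Types a b w : R.

Definition cis a : R[i] := Complex (cos a) (sin a).

Lemma cisD a b : cis (a + b) = cis a * cis b.
Proof.
by rewrite /cis cosD sinD; apply/eqP; rewrite eq_complex /= eqxx addrC eqxx.
Qed.

Lemma cis0 : cis 0 = 1.
Proof. by rewrite /cis cos0 sin0. Qed.

Lemma cisN a : cis (- a) = ((cis a)^*)%C.
Proof. by rewrite /cis cosN sinN. Qed.

Lemma cisV a : (cis a)^-1 = cis (- a).
Proof.
have cisNK : cis (- a) * cis a = 1 by rewrite -cisD addNr cis0.
rewrite -[LHS]mul1r -cisNK mulfK //; apply: contra_eq_neq cisNK => ->.
by rewrite mulr0 eq_sym oner_eq0.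
Qed.

Lemma cisX a n : cis a ^+ n = cis (n%:R * a).
Proof.
elim: n => [|n IH]; first by rewrite mul0r cis0 expr0.
by rewrite exprS IH -cisD -natr1 mulrDl mul1r addrC.
Qed.

Lemma cis_natpi n : cis (n%:R * pi) = (-1) ^+ n.
Proof.
by rewrite -cisX /cis cospi sinpi; congr (_ ^+ _); apply/eqP; rewrite eq_complex /= oppr0 !eqxx.
Qed.

Lemma cis_mul2_neq1 a : 0 < a < pi -> cis (2 * a) != 1.
Proof.
move=> a_itv; apply/eqP => -[cos1 _].
have : 2 * sin a ^+ 2 = 0 by move: cos1; rewrite mulr_natl cos_mulr2n cos2sin2 => ?; lra.
by move/eqP; rewrite mulf_eq0 pnatr_eq0 sqrf_eq0 (gt_eqF (sin_gt0_pi a_itv)).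
Qed.

Lemma sqr_normc_1Bcis w a :
  ComplexField.Normc.normc (1 - w%:C%C * cis a) ^+ 2 = (1 - w) ^+ 2 + 4 * w * sin (a / 2) ^+ 2.
Proof.
rewrite /= sqr_sqrtr ?addr_ge0 ?sqr_ge0 //.
have {1 2 3 4}-> : a = (a / 2) *+ 2 by rewrite mulr2n; field.
rewrite cos_mulr2n sin_mulr2n; have s2 := sin2cos2 (a / 2).
move: (cos _) (sin _) s2 => c s s2.
transitivity ((1 - w * (c ^+ 2 *+ 2 - 1)) ^+ 2 + 4 * w ^+ 2 * c ^+ 2 * s ^+ 2); first by ring.
by rewrite s2; ring.
Qed.

End cis.

Section poles.
Context {R : realType}.
Implicit Types u : R.

Definition unity_angle (N m : nat) : R := m.*2.+1%:R * (pi / N%:R).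

Lemma cis_unity_angleX (N m : nat) : (0 < N)%N -> cis (unity_angle N m) ^+ N = -1.
Proof.
move=> N_gt0; rewrite cisX /unity_angle mulrCA [_ * (pi / _)]mulrC divfK ?pnatr_eq0 -?lt0n //.
by rewrite cis_natpi -signr_odd /= odd_double.
Qed.

Lemma sum_cis_unity_angleX (N j : nat) : (0 < j < N)%N ->
  \sum_(m < N) cis (unity_angle N m) ^+ j = 0.
Proof.
move=> /andP[j_gt0 jN]; have N_gt0 : 0 < N%:R :> R by rewrite ltr0n (leq_trans _ jN).
pose a : R := j%:R * (pi / N%:R).
have powE m : cis (unity_angle N m) ^+ j = cis a * cis (2 * a) ^+ m.
  by rewrite !cisX -cisD; congr cis; rewrite /unity_angle /a -natr1 -muln2 natrM; ring.
under eq_bigr do rewrite powE.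
have a_itv : 0 < a < pi.
  rewrite /a mulr_gt0 ?divr_gt0 ?pi_gt0 // ?ltr0n //=.
  by rewrite mulrCA gtr_pMr ?pi_gt0 // ltr_pdivrMr // mul1r ltr_nat.
have a_neq1 : cis (2 * a) - 1 != 0 by rewrite subr_eq0; exact: cis_mul2_neq1.
rewrite -mulr_sumr.
have : (cis (2 * a) - 1) * \sum_(i < N) cis (2 * a) ^+ i = 0.
  rewrite -subrX1 cisX (_ : N%:R * (2 * a) = j.*2%:R * pi).
    by rewrite cis_natpi -signr_odd odd_double expr0 subrr.
  by rewrite /a -muln2 natrM; field; rewrite gt_eqF.
by move/eqP; rewrite mulf_eq0 (negbTE a_neq1) /= => /eqP ->; rewrite mulr0.
Qed.

(* The [N]-th roots of [- expR u]. *)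
Definition neg_expR_root u N m : R[i] := (expR (u / N%:R))%:C%C * cis (unity_angle N m).

Definition fraction_term n u N m : R[i] :=
  let z := neg_expR_root u N m in (eulerian_rec R[i] n).[z] / (N%:R * (1 - z)) ^+ n.+1.

Lemma eulerian_partial_fractions (N n : nat) u : (0 < N)%N ->
  ((eulerian_rec R n).[- expR u] / (1 + expR u) ^+ n.+1)%:C%C =
  \sum_(m < N) fraction_term n u N m.
Proof.
move=> N_gt0; set w := expR (u / N%:R).
have wN : w%:C%C ^+ N = (expR u)%:C%C.
  by rewrite -rmorphXn -expRM_natl mulrC divfK // pnatr_eq0 -lt0n.
have := @eulerian_rec_partial_fractions _ N n (fun m => cis (unity_angle N m)) w%:C%C.
rewrite wN => partial_fractions; rewrite -[RHS]partial_fractions.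
- rewrite -rmorphN -(map_eulerian_rec (real_complex R)) horner_map /=.
  by rewrite -(rmorph1 (real_complex R)) -rmorphD -rmorphXn -fmorph_div.
- by rewrite pnatr_eq0 -lt0n.
- by rewrite -(rmorph1 (real_complex R)) -rmorphD fmorph_eq0 gt_eqF.
- by move=> m; exact: cis_unity_angleX.
- exact: sum_cis_unity_angleX.
Qed.

End poles.

Local Open Scope classical_set_scope.
Local Open Scope ring_scope.

(** * The two dominant poles *)

Local Notation Re := complex.Re.
Local Notation Im := complex.Im.

Lemma cvg_horner (K : numFieldType) (T : Type) (F : set_system T) (FF : Filter F)
    (p : {poly K}) (z : T -> K) (l : K) :
  z @ F --> l -> p.[z t] @[t --> F] --> p.[l].
Proof.
move=> zl; elim/poly_ind: p => [|p c IH].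
  by rewrite horner0; under eq_fun do rewrite horner0; exact: cvg_cst.
rewrite hornerMXaddC; under eq_fun do rewrite hornerMXaddC.
by apply: cvgD; [exact: cvgM|exact: cvg_cst].
Qed.

Lemma cvg_horner_div_exp (K : numFieldType) (T : Type) (F : set_system T) (FF : Filter F)
    (p : {poly K}) n (z q : T -> K) (l m : K) : m != 0 -> z @ F --> l -> q @ F --> m ->
  p.[z t] / q t ^+ n @[t --> F] --> p.[l] / m ^+ n.
Proof.
move=> m_neq0 zl qm; apply: cvgM; first exact: cvg_horner.
apply: cvgV; first by rewrite expf_neq0.
by rewrite -hornerXn; under eq_fun do rewrite -hornerXn; exact: cvg_horner.
Qed.

Section complex_limits.
Context {R : realType}.
Local Notation C := (R[i] : numFieldType).
Implicit Types (z : nat -> C) (l : C).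

Lemma complex_ReD (x y : R[i]) : Re (x + y) = Re x + Re y.
Proof. by case: x y => a b [c d]. Qed.

Lemma complex_ReB (x y : R[i]) : Re (x - y) = Re x - Re y.
Proof. by case: x y => a b [c d]. Qed.

Lemma complex_ImB (x y : R[i]) : Im (x - y) = Im x - Im y.
Proof. by case: x y => a b [c d]. Qed.

Lemma cvg_complex z l :
  Re (z n) @[n --> \oo] --> Re l -> Im (z n) @[n --> \oo] --> Im l -> z @ \oo --> l.
Proof.
move=> /cvgrPdist_lt Re_cvg /cvgrPdist_lt Im_cvg; apply: (@cvgrPdist_lt C C _ _ _ z l).2 => e.
rewrite ltcE /= => /andP[/eqP e_real e_gt0].
have e2_gt0 : 0 < Re e / 2 by rewrite divr_gt0.
near=> n; rewrite normc_def ltcE /= e_real eqxx /= complex_ReB complex_ImB.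
rewrite -(@ger0_norm _ (Re e)) ?ltW // -sqrtr_sqr ltr_sqrt ?exprn_gt0 //.
have : `|Re l - Re (z n)| < Re e / 2 by near: n; exact: Re_cvg.
have : `|Im l - Im (z n)| < Re e / 2 by near: n; exact: Im_cvg.
by rewrite !ltr_norml => /andP[? ?] /andP[? ?]; nra.
Unshelve. all: by end_near. Qed.

Lemma cvg_Re z l : z @ \oo --> l -> Re (z n) @[n --> \oo] --> Re l.
Proof.
move=> /(@cvgrPdist_lt C C _ _ _ z l).1 z_cvg; apply/cvgrPdist_lt => e e_gt0.
have /z_cvg : 0 < (e%:C)%C by rewrite ltcR.
apply: filterS => n; rewrite -complex_ReB -ltcR; apply: le_lt_trans.
exact: normc_ge_Re.
Qed.

End complex_limits.

Section dominant_poles.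
Context {R : realType}.
Local Notation C := (R[i] : numFieldType).
Implicit Types u : R.

Lemma cvg_difference_quotient (f : R -> R) (x l : R) : is_derive x (1 : R) f l ->
  n.+1%:R * (f (n.+1%:R^-1 + x) - f x) @[n --> \oo] --> l.
Proof.
move=> [f_derivable f_derive].
have : h^-1 *: ((f \o shift x) (h *: 1) - f x) @[h --> (0 : R)^'] --> l by rewrite -f_derive.
move=> /cvgr_dnbhsP /(_ harmonic (conj (fun n => lt0r_neq0 (harmonic_gt0 n)) cvg_harmonic)).
apply: cvg_trans; apply: near_eq_cvg; apply: nearW => n.
by rewrite /harmonic /= invrK [_ *: 1]mulr1.
Qed.

Lemma is_derive_scale (c x : R) : is_derive x (1 : R) (fun h => c * h) c.
Proof. by have := is_deriveZ c (is_derive_id x (1 : R)); rewrite [c *: 1]mulr1. Qed.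

Lemma is_derive_expR_scale u : is_derive (0 : R) (1 : R) (fun h => expR (u * h)) u.
Proof.
have := @is_derive1_comp _ expR (fun h => u * h) 0 _ _ (is_derive_expR _) (is_derive_scale u 0).
by rewrite mulr0 expR0 mul1r.
Qed.

Lemma is_derive_expR_mul_comp (f : R -> R) u c df : is_derive (0 : R) (1 : R) f df ->
  is_derive (0 : R) (1 : R) (fun h => expR (u * h) * f (c * h)) (u * f 0 + c * df).
Proof.
move=> f_derive; have comp_derive : is_derive (0 : R) (1 : R) (f \o (fun h => c * h)) (c * df).
  by rewrite mulrC; apply: is_derive1_comp; [rewrite mulr0|exact: is_derive_scale].
have := is_deriveM (is_derive_expR_scale u) comp_derive.
by rewrite /= !mulr0 expR0 [1 *: _]mul1r [_ *: u]mulrC addrC.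
Qed.

Lemma Re_neg_expR_root0 u N : Re (neg_expR_root u N 0) = expR (u * N%:R^-1) * cos (pi * N%:R^-1).
Proof. by rewrite /neg_expR_root /unity_angle /cis mul1r /= mul0r subr0. Qed.

Lemma Im_neg_expR_root0 u N : Im (neg_expR_root u N 0) = expR (u * N%:R^-1) * sin (pi * N%:R^-1).
Proof. by rewrite /neg_expR_root /unity_angle /cis mul1r /= mul0r addr0. Qed.

Lemma cvg_comp_div_natS (f : R -> R) c : continuous f ->
  f (c * n.+1%:R^-1) @[n --> \oo] --> f 0.
Proof.
move=> f_cont; have cvg0 : c * n.+1%:R^-1 @[n --> \oo] --> 0.
  by rewrite -(mulr0 c); apply: cvgM; [exact: cvg_cst|exact: cvg_harmonic].
exact: (cvg_comp _ _ cvg0 (f_cont 0)).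
Qed.

Lemma cvg_neg_expR_root0 u :
  (fun n => neg_expR_root u n.+1 0 : C) @ \oo --> (1 : C).
Proof.
have expR_cvg := @cvg_comp_div_natS expR u (@continuous_expR R).
apply: cvg_complex.
  under eq_fun do rewrite Re_neg_expR_root0.
  have -> : Re 1 = expR 0 * cos 0 :> R by rewrite expR0 cos0 mulr1.
  by apply: cvgM => //; apply: cvg_comp_div_natS; exact: continuous_cos.
under eq_fun do rewrite Im_neg_expR_root0.
have -> : Im 1 = expR 0 * sin 0 :> R by rewrite sin0 mulr0.
by apply: cvgM => //; apply: cvg_comp_div_natS; exact: continuous_sin.
Qed.

Lemma cvg_natM_1Bneg_expR_root0 u :
  (fun n => n.+1%:R * (1 - neg_expR_root u n.+1 0) : C) @ \oo --> (- Complex u pi : C).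
Proof.
have natE n : n.+1%:R = (n.+1%:R)%:C%C :> R[i] by rewrite rmorph_nat.
have Re_scale (r : R) (z : R[i]) : Re (r%:C%C * z) = r * Re z by case: z => ? ? /=; ring.
have Im_scale (r : R) (z : R[i]) : Im (r%:C%C * z) = r * Im z by case: z => ? ? /=; ring.
apply: cvg_complex.
  have /cvgN := cvg_difference_quotient (is_derive_expR_mul_comp u pi (is_derive_cos _)).
  have -> : - (u * cos 0 + pi * - sin 0) = Re (- Complex u pi) by rewrite cos0 sin0 /=; ring.
  apply: cvg_trans; apply: near_eq_cvg; apply: nearW => n.
  rewrite fctE natE Re_scale complex_ReB Re_neg_expR_root0 /= !addr0 !mulr0 expR0 cos0.
  by rewrite -[LHS]mulrN opprB mulr1.
have /cvgN := cvg_difference_quotient (is_derive_expR_mul_comp u pi (is_derive_sin _)).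
have -> : - (u * sin 0 + pi * cos 0) = Im (- Complex u pi) by rewrite cos0 sin0 /=; ring.
apply: cvg_trans; apply: near_eq_cvg; apply: nearW => n.
rewrite fctE natE Im_scale complex_ImB Im_neg_expR_root0 /= !addr0 !mulr0 sin0.
by rewrite -[LHS]mulrN opprB mulr0.
Qed.

Lemma cvg_Re_fraction_term0 n u :
  Re (fraction_term n u k.+1 0) @[k --> \oo] --> Re (n`!%:R / (- Complex u pi) ^+ n.+1).
Proof.
apply: cvg_Re; rewrite -horner_eulerian_rec1.
apply: (@cvg_horner_div_exp C).
- by rewrite oppr_eq0 eq_complex /= negb_and (gt_eqF (pi_gt0 R)) orbT.
- exact: cvg_neg_expR_root0.
- exact: cvg_natM_1Bneg_expR_root0.
Qed.

Lemma fraction_term_rev n u N (m : 'I_N) :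
  fraction_term n u N (rev_ord m) = ((fraction_term n u N m)^*)%C.
Proof.
have N_neq0 : N%:R != 0 :> R by rewrite pnatr_eq0 -lt0n (leq_ltn_trans _ (ltn_ord m)).
have angle_rev : unity_angle N (rev_ord m) = 2%:R * pi - unity_angle N m :> R.
  rewrite /unity_angle; have -> : (rev_ord m).*2.+1 = (N.*2 - m.*2.+1)%N.
    by have := ltn_ord m; rewrite /=; lia.
  rewrite natrB; first by rewrite -muln2 natrM; field.
  by have := ltn_ord m; lia.
have root_rev : neg_expR_root u N (rev_ord m) = ((neg_expR_root u N m)^*)%C.
  by rewrite /neg_expR_root angle_rev cisD cis_natpi sqrrN expr1n mul1r cisN [RHS]rmorphM /= oppr0.
rewrite /fraction_term root_rev -[in LHS](map_eulerian_rec (@conjc R)) horner_map /=.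
by rewrite [RHS]fmorph_div rmorphXn rmorphM rmorphB rmorph1 rmorph_nat.
Qed.

End dominant_poles.

(** * The remaining poles *)

Local Notation normc := ComplexField.Normc.normc.

Section remainder.
Context {R : realType}.
Implicit Types (u x : R).

Lemma normc_ge0 (z : R[i]) : 0 <= normc z.
Proof. by case: z => ? ?; exact: sqrtr_ge0. Qed.

Lemma Re_le_normc (z : R[i]) : `|Re z| <= normc z.
Proof. by rewrite -lecR; exact: normc_ge_Re. Qed.

Lemma normcX (z : R[i]) n : normc (z ^+ n) = normc z ^+ n.
Proof. by apply: complexI; rewrite rmorphXn; exact: normrX. Qed.

Lemma normc_nat n : normc (n%:R : R[i]) = n%:R.
Proof. by rewrite normcMn ComplexField.Normc.normc1. Qed.

Lemma normc_sum n (F : 'I_n -> R[i]) : normc (\sum_i F i) <= \sum_i normc (F i).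
Proof. by rewrite -lecR rmorph_sum; exact: (ler_norm_sum _ F xpredT). Qed.

(* Jordan's inequality: by the mean value theorem and the monotonicity of [cos], the
   chord of [sin] over [0, x] is steeper than the chord over [x, pi / 2]. *)
Lemma sin_ge_chord x : 0 <= x <= pi / 2 -> 2 * x / pi <= sin x.
Proof.
have pi0 := @pi_gt0 R; move=> /andP[].
rewrite le_eqVlt => /predU1P[<-|x_gt0]; first by rewrite mulr0 mul0r sin0.
rewrite le_eqVlt => /predU1P[->|x_lt].
  by rewrite sin_pihalf mulrCA divff // mulr1 divff // gt_eqF.
have chord (a b : R) : 0 <= a -> a < b ->
    exists2 y, a < y < b & sin b - sin a = cos y * (b - a).
  move=> a_ge0 ab; have [|y yI ->] := MVT ab (fun y _ => is_derive_sin y); last by exists y.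
  by apply: continuous_subspaceT; exact: continuous_sin.
have [y /andP[y_gt0 yx] sinx] := chord _ _ (lexx 0) x_gt0.
have [y' /andP[xy' y'_lt] sin1] := chord _ _ (ltW x_gt0) x_lt.
rewrite sin0 !subr0 in sinx; rewrite sin_pihalf in sin1.
have le_cos : cos y' <= cos y.
  by rewrite leNgt ltr_cos ?in_itv /= -?leNgt; [|apply/andP; split; lra..]; lra.
have : x * (1 - sin x) <= (pi / 2 - x) * sin x.
  rewrite sin1 [in leRHS]sinx [leRHS]mulrC -mulrA -[leLHS]mulrCA ler_wpM2r //.
  by rewrite mulr_ge0 ?subr_ge0 // ltW.
rewrite ler_pdivrMr //; lra.
Qed.

(* [|u + i k pi|] with [k = pole_index N m] is the limit of [N |1 - neg_expR_root u N m|]. *)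
Definition pole_index (N m : nat) : nat := minn m.*2.+1 (N - m.+1).*2.+1.

Lemma pole_index_le_sin N m : (m < N)%N ->
  (pole_index N m)%:R <= N%:R * sin (unity_angle N m / 2) :> R.
Proof.
move=> mN; have pi0 := @pi_gt0 R; have N_gt0 : 0 < N%:R :> R by rewrite ltr0n (leq_trans _ mN).
have chord (k : nat) : (k <= N)%N -> k%:R <= N%:R * sin (k%:R * (pi / N%:R) / 2) :> R.
  move=> kN; rewrite mulrC -ler_pdivrMr //.
  have -> : k%:R / N%:R = 2 * (k%:R * (pi / N%:R) / 2) / pi :> R.
    by move: (pi : R) pi0 => p p_gt0; field; rewrite !gt_eqF.
  apply: sin_ge_chord; rewrite !mulr_ge0 ?invr_ge0 ?(ltW pi0) //=.
  by rewrite ler_pM2r ?invr_gt0 // mulrCA ger_pMr // ler_pdivrMr // mul1r ler_nat.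
have [m_le|m_gt] := leqP m.*2.+1 N.
  by rewrite (le_trans _ (chord _ m_le)) // ler_nat geq_minl.
have sin_rev : sin (unity_angle N m / 2) = sin ((N - m.+1).*2.+1%:R * (pi / N%:R) / 2) :> R.
  have -> : (N - m.+1).*2.+1 = (N.*2 - m.*2.+1)%N by lia.
  rewrite -[LHS]opprK -[in RHS]mulrA natrB; last lia.
  have -> : (N.*2%:R - m.*2.+1%:R) * (pi / N%:R / 2) = - (unity_angle N m / 2) + pi :> R.
    by rewrite /unity_angle -muln2 natrM; field; rewrite gt_eqF.
  by rewrite sinDpi sinN.
rewrite sin_rev (le_trans _ (chord _ _)) ?ler_nat ?geq_minr //; lia.
Qed.

Lemma sum_inv_sqr_odd_le M : \sum_(m < M) (m.*2.+3%:R ^+ 2)^-1 <= 1 / 4 :> R.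
Proof.
suff : \sum_(m < M) (m.*2.+3%:R ^+ 2)^-1 <= 1 / 4 - (4 * M.+1%:R)^-1 :> R.
  by move=> /le_trans; apply; rewrite gerBl invr_ge0 mulr_ge0.
elim: M => [|M IH]; first by rewrite big_ord0 mulr1 div1r subrr.
rewrite big_ord_recr /= (le_trans (lerD IH (lexx _))) //.
have -> : M.*2.+3%:R = 2 * M%:R + 3 :> R by rewrite -addn3 natrD -mul2n natrM.
have -> : M.+1%:R = M%:R + 1 :> R by rewrite natr1.
have -> : M.+2%:R = M%:R + 2 :> R by rewrite -addn2 natrD.
have : 0 <= M%:R :> R by [].
move: M%:R => x x0.
have telescope : ((2 * x + 3) ^+ 2)^-1 <= (4 * (x + 1) * (x + 2))^-1.
  by rewrite lef_pV2 ?posrE ?exprn_gt0 ?mulr_gt0 //; [nra|lra|lra|lra].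
have -> : (4 * (x + 2))^-1 = (4 * (x + 1))^-1 - (4 * (x + 1) * (x + 2))^-1.
  by field; apply/andP; split; apply: lt0r_neq0; lra.
lra.
Qed.

Lemma sum_inv_sqr_pole_index_le M :
  \sum_(m < M) ((pole_index M.+2 m.+1)%:R ^+ 2)^-1 <= 1 / 2 :> R.
Proof.
apply: (@le_trans _ _ (\sum_(m < M) ((m.*2.+3%:R ^+ 2)^-1 + ((rev_ord m).*2.+3%:R ^+ 2)^-1))).
  apply: ler_sum => m _; have -> : pole_index M.+2 m.+1 = minn m.*2.+3 (rev_ord m).*2.+3.
    by rewrite /pole_index /= -doubleS; congr minn; have := ltn_ord m; lia.
  by case: leqP => _; rewrite ?lerDl ?lerDr invr_ge0 sqr_ge0.
rewrite big_split /= [X in _ + X](reindex_inj rev_ord_inj) /=.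
under [X in _ + X]eq_bigr do rewrite -[(_ - _)%N]/(val (rev_ord (rev_ord _))) rev_ordK.
have := sum_inv_sqr_odd_le M; lra.
Qed.

Lemma sqr_normc_1Bneg_expR_root u N m :
  normc (N%:R * (1 - neg_expR_root u N m)) ^+ 2 =
  (N%:R * (1 - expR (u / N%:R))) ^+ 2 +
  4 * expR (u / N%:R) * (N%:R * sin (unity_angle N m / 2)) ^+ 2.
Proof.
by rewrite ComplexField.Normc.normcM exprMn normc_nat sqr_normc_1Bcis; ring.
Qed.

Section large_degree.
(* For a fixed [u], these conditions hold as soon as [N] is large. *)
Variables (u : R) (N : nat).
Let w := expR (u / N%:R).
Hypotheses (w_ge : 8 / 9 <= w) (w_dist : u ^+ 2 - 1 <= (N%:R * (1 - w)) ^+ 2).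

Lemma sqr_normc_pole_ge m : (0 < m)%N -> (m.+1 < N)%N ->
  Num.max (u ^+ 2 + 3 / 2 * pi ^+ 2) ((pole_index N m)%:R ^+ 2) <=
  normc (N%:R * (1 - neg_expR_root u N m)) ^+ 2.
Proof.
move=> m_gt0 mN; rewrite sqr_normc_1Bneg_expR_root -/w.
set s := N%:R * sin _; set b : R := (pole_index N m)%:R.
have b_ge3 : 3 <= b by rewrite ler_nat /pole_index; lia.
have b_le_s : b ^+ 2 <= s ^+ 2.
  have bs : b <= s := pole_index_le_sin (ltnW mN).
  by rewrite lerXn2r ?nnegrE // (le_trans _ bs) // ler0n.
have b2_ge9 : 9 <= b ^+ 2 by nra.
have ws : 8 / 9 * b ^+ 2 <= w * s ^+ 2 by rewrite ler_pM // ?sqr_ge0.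
have pi2_le : pi ^+ 2 <= 16 :> R by have := @pi_gt0 R; have := pihalf_lt2 R; nra.
have u2_ge0 := sqr_ge0 u; move: ((N%:R * (1 - w)) ^+ 2) w_dist => d d_ge.
by rewrite ge_max; apply/andP; split; lra.
Qed.

Lemma normc_fraction_term k m : w ^+ k.+1 <= 2 -> (0 < m)%N -> (m.+1 < N)%N ->
  normc (fraction_term k.+1 u N m) <=
  2 * k.+1`!%:R / Num.sqrt (u ^+ 2 + 3 / 2 * pi ^+ 2) ^+ k * ((pole_index N m)%:R ^+ 2)^-1.
Proof.
move=> wk m_gt0 mN; rewrite /fraction_term; set z := neg_expR_root u N m.
rewrite ComplexField.Normc.normcM ComplexField.Normc.normcV normcX.
have := sqr_normc_pole_ge m_gt0 mN; rewrite ge_max -/z.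
set D := normc (N%:R * (1 - z)); set q := Num.sqrt _; set b := pole_index N m => /andP[qD bD].
have D_ge0 : 0 <= D := normc_ge0 _.
have q_gt0 : 0 < q by rewrite sqrtr_gt0 ltr_wpDl ?sqr_ge0 // mulr_gt0 // exprn_gt0 // pi_gt0.
have {}qD : q <= D by rewrite -(ger0_norm D_ge0) -sqrtr_sqr ler_sqrt // sqr_ge0.
have D_gt0 : 0 < D := lt_le_trans q_gt0 qD.
have b_gt0 : 0 < b%:R :> R by rewrite ltr0n /b /pole_index; lia.
have norm_num : normc (eulerian_rec R[i] k.+1).[z] <= 2 * k.+1`!%:R.
  have normz : `|z| = w%:C%C.
    rewrite normrM normc_def /cis /= expr0n /= addr0 sqrtr_sqr ger0_norm ?expR_ge0 //.
    by rewrite normc_def /= cos2Dsin2 sqrtr1 mulr1.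
  rewrite -lecR mulrC rmorphM !rmorph_nat; apply: norm_horner_eulerian_rec; first by rewrite ler1n.
  by rewrite normz -rmorphXn -(rmorph_nat (real_complex R)) lecR.
rewrite -addn2 exprD invfM mulrA; apply: ler_pM.
- by rewrite divr_ge0 ?exprn_ge0 ?normc_ge0.
- by rewrite invr_ge0 exprn_ge0.
- rewrite ler_pM ?invr_ge0 ?exprn_ge0 ?normc_ge0 // lef_pV2 ?posrE ?exprn_gt0 //.
  by rewrite lerXn2r ?nnegrE // ltW.
- by rewrite lef_pV2 ?posrE ?exprn_gt0.
Qed.

End large_degree.

Lemma cvg_expR_div_natS u : expR (u / n.+1%:R) @[n --> \oo] --> (1 : R).
Proof. by have := cvg_comp_div_natS u (@continuous_expR R); rewrite expR0. Qed.

Lemma cvg_natM_1BexpR u : n.+1%:R * (1 - expR (u / n.+1%:R)) @[n --> \oo] --> - u.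
Proof.
have /cvgN := cvg_difference_quotient (is_derive_expR_scale u).
apply: cvg_trans; apply: near_eq_cvg; apply: nearW => n.
by rewrite fctE addr0 mulr0 expR0 -mulrN opprB.
Qed.

Lemma Re_partial_fractions n u M :
  (eulerian_rec R n).[- expR u] / (1 + expR u) ^+ n.+1 =
  2 * Re (fraction_term n u M.+2 0) + Re (\sum_(m < M) fraction_term n u M.+2 m.+1).
Proof.
have := eulerian_partial_fractions n u (ltn0Sn M.+1).
rewrite big_ord_recl big_ord_recr /= => /(congr1 (@Re R)).
rewrite [LHS]/= !complex_ReD => ->.
have -> : fraction_term n u M.+2 (bump 0 M) = ((fraction_term n u M.+2 0)^*)%C.
  by rewrite -[0%N]/(val (@ord0 M.+1)) -fraction_term_rev /= subn1.
rewrite [Re (_ ^*)%C](_ : _ = Re (fraction_term n u M.+2 0)); last by case: fraction_term.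
by rewrite addrA addrAC -mulr2n mulr_natl.
Qed.

Lemma eulerian_two_poles_finite k u N : (1 < N)%N ->
  let w := expR (u / N%:R) in
  8 / 9 <= w -> w ^+ k.+1 <= 2 -> u ^+ 2 - 1 <= (N%:R * (1 - w)) ^+ 2 ->
  `|(eulerian_rec R k.+1).[- expR u] / (1 + expR u) ^+ k.+2
    - 2 * Re (fraction_term k.+1 u N 0)| <=
  k.+1`!%:R / Num.sqrt (u ^+ 2 + 3 / 2 * pi ^+ 2) ^+ k.
Proof.
case: N => [|[|M]] // _ w w_ge wk w_dist.
rewrite (Re_partial_fractions _ _ M) [X in X - _]addrC addrK.
apply: le_trans (Re_le_normc _) _; apply: le_trans (normc_sum _) _.
apply: (@le_trans _ _ (\sum_(m < M) (2 * k.+1`!%:R / Num.sqrt (u ^+ 2 + 3 / 2 * pi ^+ 2) ^+ k *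
    ((pole_index M.+2 m.+1)%:R ^+ 2)^-1))).
  by apply: ler_sum => m _; apply: normc_fraction_term; rewrite ?ltnS.
set q := Num.sqrt _ ^+ k; have q_ge0 : 0 <= q by rewrite exprn_ge0 ?sqrtr_ge0.
rewrite -mulr_sumr -(mulrA 2) -[leRHS]mulr1 [2 * _]mulrC -[leLHS]mulrA ler_wpM2l ?divr_ge0 //.
by have := sum_inv_sqr_pole_index_le M; lra.
Qed.

Lemma eulerian_two_poles k u :
  `|(eulerian_rec R k.+1).[- expR u] / (1 + expR u) ^+ k.+2
    - 2 * Re (k.+1`!%:R / (- Complex u pi) ^+ k.+2)| <=
  k.+1`!%:R / Num.sqrt (u ^+ 2 + 3 / 2 * pi ^+ 2) ^+ k.
Proof.
set S := _ / _ ^+ _; set main := Re (_ / _).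
have : `|S - 2 * Re (fraction_term k.+1 u n.+1 0)| @[n --> \oo] --> `|S - 2 * main|.
  apply: cvg_norm; apply: cvgB; first exact: cvg_cst.
  by apply: cvgM; [exact: cvg_cst|exact: cvg_Re_fraction_term0].
move=> /cvgr_to_le; apply; near=> n; apply: eulerian_two_poles_finite.
- by rewrite ltnS; near: n; exists 1%N.
- near: n; apply: (cvgr_ge (1 : R)); [exact: cvg_expR_div_natS|lra].
- near: n; apply: (cvgr_le (1 ^+ k.+1 : R)); last by rewrite expr1n ltr1n.
  exact: (cvg_comp _ _ (cvg_expR_div_natS u) (@exprn_continuous R k.+1 _)).
- near: n; apply: (cvgr_ge ((- u) ^+ 2)); last by rewrite sqrrN ltrBlDr ltrDl.
  by under eq_fun do rewrite expr2; rewrite expr2; apply: cvgM; exact: cvg_natM_1BexpR.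
Unshelve. all: by end_near. Qed.

End remainder.

(** * Signs at the quantiles of the limit law *)

Section cauchy_quantile.
Context {R : realType}.
Implicit Types p x y : R.

Definition cauchy_cdf x : R := 2^-1 + atan x / pi.

Definition cauchy_quantile p : R := tan (pi * (p - 2^-1)).

Lemma cauchy_cdf_itv x : 0 < cauchy_cdf x < 1.
Proof.
have pi0 := @pi_gt0 R; have atan_gt := atan_gtNpi2 x; have atan_lt := atan_ltpi2 x.
have : - 2^-1 < atan x / pi < 2^-1.
  by rewrite ltr_pdivlMr // ltr_pdivrMr //; apply/andP; split; lra.
by rewrite /cauchy_cdf => /andP[? ?]; apply/andP; split; lra.
Qed.

Lemma lt_cauchy_cdf : {homo cauchy_cdf : x y / x < y}.
Proof. by move=> x y xy; rewrite ltrD2l ltr_pM2r ?invr_gt0 ?pi_gt0 // lt_atan. Qed.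

Lemma cauchy_cdfK : cancel cauchy_cdf cauchy_quantile.
Proof.
move=> x; rewrite /cauchy_quantile /cauchy_cdf addrAC subrr add0r mulrC divfK ?atanK //.
by rewrite gt_eqF // pi_gt0.
Qed.

Lemma mulr_pi_subV2_itv p : 0 < p < 1 -> pi * (p - 2^-1) \in `](- (pi / 2)), (pi / 2)[.
Proof. by have := @pi_gt0 R; rewrite in_itv /= => ? /andP[? ?]; apply/andP; split; nra. Qed.

Lemma cauchy_quantileK p : 0 < p < 1 -> cauchy_cdf (cauchy_quantile p) = p.
Proof.
move=> /mulr_pi_subV2_itv p_itv; rewrite /cauchy_cdf /cauchy_quantile tanK //.
by rewrite mulrAC divff ?gt_eqF ?pi_gt0 // mul1r addrC subrK.
Qed.

Lemma lt_cauchy_quantile p q : 0 < p -> q < 1 -> p < q -> cauchy_quantile p < cauchy_quantile q.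
Proof.
move=> p_gt0 q_lt1 pq; rewrite /cauchy_quantile ltr_tan.
- by rewrite ltr_pM2l ?pi_gt0 // ltrD2r.
- by apply: mulr_pi_subV2_itv; rewrite p_gt0 (lt_trans pq).
- by apply: mulr_pi_subV2_itv; rewrite q_lt1 (lt_trans p_gt0).
Qed.

Lemma le_cauchy_quantile p q : 0 < p -> q < 1 -> p <= q -> cauchy_quantile p <= cauchy_quantile q.
Proof.
move=> p_gt0 q_lt1; rewrite le_eqVlt => /predU1P[-> //|pq].
by rewrite ltW // lt_cauchy_quantile.
Qed.

Lemma cauchy_quantile_cot p : cauchy_quantile p = - (cos (pi * p) / sin (pi * p)).
Proof.
by rewrite /cauchy_quantile /tan mulrBr sinBpihalf cosBpihalf mulNr.
Qed.

End cauchy_quantile.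

Section eulerian_sign.
Context {R : realType}.
Implicit Types (p u U : R).

Lemma sin_pi_gt0 p : 0 < p < 1 -> 0 < sin (pi * p).
Proof.
move=> /andP[p_gt0 p_lt1]; apply: sin_gt0_pi.
by rewrite mulr_gt0 ?pi_gt0 //= gtr_pMr ?pi_gt0.
Qed.

Lemma dominant_pole_polar p : 0 < p < 1 ->
  - Complex (pi * cauchy_quantile p) pi = (pi / sin (pi * p))%:C%C * cis (- (pi * p)).
Proof.
move=> /sin_pi_gt0 sin_gt0; rewrite cauchy_quantile_cot /cis cosN sinN.
apply/eqP; rewrite eq_complex /= !mul0r addr0 subr0 mulrN opprK mulrA mulrAC eqxx /=.
by rewrite mulrN divfK // gt_eqF.
Qed.

Lemma Re_dominant_pole n j p : 0 < p < 1 -> n.+1%:R * p = j%:R ->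
  Re (n`!%:R / (- Complex (pi * cauchy_quantile p) pi) ^+ n.+1) =
  (-1) ^+ j * (n`!%:R * (sin (pi * p) / pi) ^+ n.+1).
Proof.
move=> p_itv np; rewrite (dominant_pole_polar p_itv) exprMn invfM -!exprVn cisV opprK cisX.
rewrite [n.+1%:R * _]mulrCA np [pi * j%:R]mulrC cis_natpi -fmorphV invf_div -rmorphXn.
by rewrite -(rmorph_nat (real_complex R)) -(rmorph_sign (real_complex R)) -!rmorphM /= mulrA mulrC.
Qed.

Lemma sqr_dominant_pole_norm p : 0 < p < 1 ->
  (pi / sin (pi * p)) ^+ 2 = (pi * cauchy_quantile p) ^+ 2 + pi ^+ 2.
Proof.
move=> /sin_pi_gt0 sin_gt0; rewrite cauchy_quantile_cot mulrN sqrrN.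
transitivity (pi ^+ 2 * (cos (pi * p) ^+ 2 + sin (pi * p) ^+ 2) / sin (pi * p) ^+ 2).
  by rewrite cos2Dsin2 mulr1 expr_div_n.
by rewrite mulrDr mulrDl mulfK ?expf_neq0 ?gt_eqF // [in RHS]mulrA expr_div_n exprMn.
Qed.

Lemma near_mul_exp_le1 (c r : R) : 0 <= r < 1 -> \forall k \near \oo, c * r ^+ k <= 1.
Proof.
move=> /andP[r_ge0 r_lt1]; have : geometric c r k @[k --> \oo] --> (0 : R).
  by apply: cvg_geometric; rewrite ger0_norm.
by move=> /(cvgr_le (0 : R)); apply.
Qed.

Lemma near_pole_domination U : \forall k \near \oo, forall u, `|u| <= U ->
  (u ^+ 2 + pi ^+ 2) ^+ k.+2 <= (u ^+ 2 + 3 / 2 * pi ^+ 2) ^+ k.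
Proof.
pose P : R := pi ^+ 2; have P_gt0 : 0 < P by rewrite exprn_gt0 // pi_gt0.
have U2_ge0 := sqr_ge0 U; pose r : R := (U ^+ 2 + P) / (U ^+ 2 + 3 / 2 * P).
have den_gt0 : 0 < U ^+ 2 + 3 / 2 * P by lra.
have r_itv : 0 <= r < 1.
  apply/andP; split; first by rewrite divr_ge0 // ?(ltW den_gt0) // addr_ge0 // ltW.
  by rewrite ltr_pdivrMr // mul1r; lra.
apply: filterS (near_mul_exp_le1 ((U ^+ 2 + P) ^+ 2) r_itv) => k rk u uU.
have u2_ge0 := sqr_ge0 u; have u2_le : u ^+ 2 <= U ^+ 2.
  by rewrite -(ger0_norm u2_ge0) normrX lerXn2r ?nnegrE // (le_trans _ uU).
set A := u ^+ 2 + P; set B := u ^+ 2 + 3 / 2 * P.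
have A_ge0 : 0 <= A by rewrite addr_ge0 // ltW.
have AB : A <= r * B by rewrite /r mulrAC ler_pdivlMr // /A /B; nra.
rewrite -addn2 exprD mulrC; apply: (@le_trans _ _ ((U ^+ 2 + P) ^+ 2 * (r * B) ^+ k)).
  by rewrite ler_pM ?exprn_ge0 // lerXn2r ?nnegrE ?lerD2r // (le_trans A_ge0) // lerD2r.
by rewrite exprMn mulrA ler_piMl // exprn_ge0 // addr_ge0 // mulr_ge0 // ltW.
Qed.

Lemma near_remainder_le_main U : \forall k \near \oo, forall p, 0 < p < 1 ->
  `|pi * cauchy_quantile p| <= U ->
  k.+1`!%:R / Num.sqrt ((pi * cauchy_quantile p) ^+ 2 + 3 / 2 * pi ^+ 2) ^+ k <=
  k.+1`!%:R * (sin (pi * p) / pi) ^+ k.+2.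
Proof.
apply: filterS (near_pole_domination U) => k domination p p_itv uU.
have {domination} := domination _ uU; rewrite -sqr_dominant_pole_norm //.
have rho_gt0 : 0 < pi / sin (pi * p) by rewrite divr_gt0 ?pi_gt0 ?sin_pi_gt0.
rewrite -[sin _ / pi]invf_div; move: (pi / _) rho_gt0 => rho rho_gt0.
have : 0 < (pi * cauchy_quantile p) ^+ 2 + 3 / 2 * pi ^+ 2.
  by rewrite ltr_wpDl ?sqr_ge0 // mulr_gt0 // exprn_gt0 // pi_gt0.
move: (_ + _) => B B_gt0 domination.
rewrite ler_wpM2l // exprVn lef_pV2 ?posrE ?exprn_gt0 ?sqrtr_gt0 //.
rewrite -(@ler_pXn2r _ 2) ?nnegrE ?exprn_ge0 ?sqrtr_ge0 ?(ltW rho_gt0) //.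
by rewrite exprAC [leRHS]exprAC sqr_sqrtr // ltW.
Qed.

Definition eulerian_quantile p : R := expR (pi * cauchy_quantile p).

Lemma eulerian_rec_sign_quantile (a b : R) : 0 < a -> b < 1 ->
  \forall n \near \oo, forall j : nat, a <= j%:R / n.+1%:R <= b ->
    0 < (-1) ^+ j * (eulerian_rec R n).[- eulerian_quantile (j%:R / n.+1%:R)].
Proof.
move=> a_gt0 b_lt1.
pose U : R := pi * (`|cauchy_quantile a| + `|cauchy_quantile b|).
have [k0 _ remainder_le_main] := near_remainder_le_main U.
exists k0.+1 => // -[//|k] k0k j /andP[]; set p := j%:R / _ => ap pb.
have p_itv : 0 < p < 1 by rewrite (lt_le_trans a_gt0) ?(le_lt_trans pb).
have /andP[p_gt0 p_lt1] := p_itv.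
have uU : `|pi * cauchy_quantile p| <= U.
  rewrite normrM (ger0_norm (pi_ge0 R)) ler_wpM2l ?pi_ge0 //.
  have := le_cauchy_quantile a_gt0 p_lt1 ap; have := le_cauchy_quantile p_gt0 b_lt1 pb.
  have := ler_norm (cauchy_quantile b); have := ler_norm (- cauchy_quantile a).
  rewrite normrN ler_norml => ? ? ? ?.
  have ? := normr_ge0 (cauchy_quantile a); have ? := normr_ge0 (cauchy_quantile b).
  by apply/andP; split; lra.
have := le_trans (eulerian_two_poles k _) (remainder_le_main k k0k p p_itv uU).
rewrite (@Re_dominant_pole k.+1 j) //; last by rewrite /p mulrC divfK.
rewrite -/(eulerian_quantile p).
set main := _ * _ ^+ _; have main_gt0 : 0 < main.
  by rewrite mulr_gt0 ?ltr0n ?fact_gt0 // exprn_gt0 // divr_gt0 ?pi_gt0 ?sin_pi_gt0.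
have den_gt0 : 0 < (1 + eulerian_quantile p) ^+ k.+2 by rewrite exprn_gt0 // addr_gt0 ?expR_gt0.
rewrite -(@pmulr_lgt0 _ ((1 + eulerian_quantile p) ^- k.+2)) ?invr_gt0 // -mulrA.
move: (_ / _) => E; rewrite -signr_odd; case: (odd j); rewrite ?expr1 ?expr0.
all: by rewrite ler_norml => /andP[? ?]; lra.
Qed.

End eulerian_sign.

(** * Counting roots *)

Lemma card_roots_ge_sign_changes (R : rcfType) (p : {poly R}) n (r : 'I_n -> R)
    (v : nat -> R) K :
  (forall z, root p z -> exists k, z = r k) ->
  (forall i, (i < K)%N -> v i.+1 < v i) ->
  (forall i, (i < K)%N -> p.[v i.+1] * p.[v i] < 0) ->
  (K <= #|[set k | (v K < r k < v 0)%R]%SET|)%N.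
Proof.
move=> p_roots; elim: K => // K IH v_decr p_sign.
have v_le i : (i <= K)%N -> v i <= v 0.
  by elim: i => // i IHi iK; exact: le_trans (ltW (v_decr _ (leqW iK))) (IHi (ltnW iK)).
have [||z z_itv /p_roots[k0 z_eq]] := @polyrcf.poly_ivtoo R p (v K.+1) (v K).
- exact/ltW/v_decr.
- exact: p_sign.
move: z_itv; rewrite z_eq in_itv /= => /andP[vz zv].
have : k0 |: [set k | v K < r k < v 0]%SET \subset [set k | v K.+1 < r k < v 0]%SET.
  apply/fintype.subsetP => k; rewrite !inE => /predU1P[->|/andP[vr rv]].
    by rewrite vz (lt_le_trans zv) ?v_le.
  by rewrite rv andbT (lt_trans _ vr) ?v_decr.
move=> /subset_leq_card; apply: leq_trans; rewrite cardsU1 inE [_ < r k0]lt_gtF // ltnS.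
by apply: IH => i iK; [apply: v_decr|apply: p_sign]; rewrite ltnS ltnW.
Qed.

Section root_count.
Context {R : realType}.
Implicit Types (a b : R).

Lemma lt_eulerian_quantile a b : 0 < a -> b < 1 -> a < b ->
  eulerian_quantile a < eulerian_quantile b.
Proof.
by move=> a_gt0 b_lt1 ab; rewrite ltr_expR ltr_pM2l ?pi_gt0 // lt_cauchy_quantile.
Qed.

Lemma le_eulerian_quantile a b : 0 < a -> b < 1 -> a <= b ->
  eulerian_quantile a <= eulerian_quantile b.
Proof.
by move=> a_gt0 b_lt1 ab; rewrite ler_expR ler_pM2l ?pi_gt0 // le_cauchy_quantile.
Qed.

Lemma grid_points (N a b : R) : 0 < N -> 0 <= a <= b ->
  exists J K : nat, (forall i, (i < K)%N -> a <= (J + i)%:R / N <= b) /\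
                    N * (b - a) - 1 <= K%:R.
Proof.
move=> N_gt0 /andP[a_ge0 ab]; have b_ge0 := le_trans a_ge0 ab.
have /andP[a_ge a_lt] := truncn_itv (mulr_ge0 (ltW N_gt0) a_ge0).
have /andP[b_ge b_lt] := truncn_itv (mulr_ge0 (ltW N_gt0) b_ge0).
set J := Num.truncn (N * a) in a_ge a_lt; set J' := Num.truncn (N * b) in b_ge b_lt.
exists J.+1, (J'.+1 - J.+1)%N; split => [i iK|].
  rewrite ler_pdivlMr // ler_pdivrMr // [a * N]mulrC [b * N]mulrC.
  by rewrite (le_trans (ltW a_lt)) ?ler_nat ?leq_addr //= (le_trans _ b_ge) ?ler_nat //; lia.
have : J'.+1%:R <= J.+1%:R + (J'.+1 - J.+1)%:R :> R by rewrite -natrD ler_nat -leq_subLR.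
by rewrite -[J.+1%:R]natr1 mulrBr; lra.
Qed.

Lemma eulerian_root_count a b : 0 < a -> a <= b -> b < 1 -> \forall n \near \oo,
  forall y : nat -> R, eulerian_roots n.+1 y ->
  n.+1%:R * (b - a) - 2 <=
  #|[set k : 'I_n.+1 | eulerian_quantile a < - y k.+1 <= eulerian_quantile b]%SET|%:R.
Proof.
move=> a_gt0 ab b_lt1; have [n0 _ sign] := eulerian_rec_sign_quantile a_gt0 b_lt1.
exists n0 => // n n0n y y_roots; set count := #|_|.
have /= := @grid_points n.+2%:R a b (ltr0Sn _ _); rewrite (ltW a_gt0) => /(_ ab) [J [K]].
have : n.+1%:R * (b - a) <= n.+2%:R * (b - a) by rewrite ler_wpM2r ?subr_ge0 ?ler_nat.
move: (n.+1%:R * _) (n.+2%:R * _) => m N mN.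
case: K => [|K] [grid K_ge]; first by have := ler0n R count; lra.
pose q i : R := eulerian_quantile ((J + i)%:R / n.+2%:R).
have q_homo i j : (i < j)%N -> (j <= K)%N -> q i < q j.
  move=> ij jK; have /andP[ai _] := grid i (leq_trans ij (leqW jK)).
  have /andP[_ jb] := grid j jK; apply: lt_eulerian_quantile.
  - exact: lt_le_trans ai.
  - exact: le_lt_trans b_lt1.
  - by rewrite ltr_pM2r ?invr_gt0 // ltr_nat ltn_add2l.
have sign_change i : (i < K)%N ->
    (eulerian_rec R n.+1).[- q i.+1] * (eulerian_rec R n.+1).[- q i] < 0.
  move=> iK; have := mulr_gt0 (sign n.+1 (leqW n0n) _ (grid i.+1 iK))
    (sign n.+1 (leqW n0n) _ (grid i (leqW iK))).
  by rewrite mulrACA -exprD addnS addSn addnn -signr_odd /= odd_double expr1 mulN1r oppr_gt0 -addnS.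
have roots z : root (eulerian_rec R n.+1) z -> exists k : 'I_n.+1, z = y k.+1.
  rewrite -eulerian_polyE => /(eulerian_rootsP y_roots)[[//|k] kn ->].
  by exists (Ordinal (kn : (k < n.+1)%N)).
have : (K <= #|[set k : 'I_n.+1 | (- q K < y k.+1 < - q 0%N)%R]%SET|)%N.
  apply: (card_roots_ge_sign_changes (v := fun i => - q i) roots) => // i iK.
  by rewrite ltrN2 q_homo.
have /subset_leq_card : [set k : 'I_n.+1 | (- q K < y k.+1 < - q 0%N)%R]%SET \subset
    [set k : 'I_n.+1 | eulerian_quantile a < - y k.+1 <= eulerian_quantile b]%SET.
  apply/fintype.subsetP => k; rewrite !inE ltrNl ltrNr => /andP[y_lt y_gt].
  have /andP[a_le0 le0_b] := grid 0%N (ltn0Sn K); have /andP[a_leK leK_b] := grid K (ltnSn K).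
  have q_ge : eulerian_quantile a <= q 0%N.
    by apply: le_eulerian_quantile => //; exact: le_lt_trans b_lt1.
  have q_le : q K <= eulerian_quantile b.
    by apply: le_eulerian_quantile => //; exact: lt_le_trans a_leK.
  by rewrite (le_lt_trans q_ge) //= (le_trans (ltW y_lt)).
move=> /[swap] /leq_trans /[apply]; rewrite -(ler_nat R) -/count.
by move: K_ge; rewrite -[K.+1%:R]natr1; lra.
Qed.

End root_count.

(** * Weak convergence *)

Section real_line.
Context {R : realType}.
Implicit Types (f : R -> R) (m : probability R R) (a b c e s t : R).

Lemma uniform_continuity_segment f a b e : continuous f -> 0 < e ->
  exists2 r, 0 < r & forall x y, a <= x <= b -> `|x - y| < r -> `|f x - f y| <= e.
Proof.
move=> f_cont e_gt0; pose small_osc (r x : R) := forall y, `|x - y| < r -> `|f x - f y| <= e.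
have : \forall r \near 0^'+, `[a, b]%classic `<=` small_osc r.
  have /compact_near_coveringP := @segment_compact R a b; apply => x _.
  have : \forall y \near x, `|f x - f y| < e / 2.
    by move/cvgrPdist_lt : (f_cont x); apply; rewrite divr_gt0.
  move=> [r /= r_gt0 f_near].
  exists (ball x (r / 2), [set q | q < r / 2]).
    by split => /=; [apply: nbhsx_ballx|apply: nbhs_right_lt]; rewrite divr_gt0.
  move=> [x' q] /= [xx' qr] y x'y; have {}xx' : `|x - x'| < r / 2 := xx'.
  rewrite -[f x' - f y](subrKA (f x)) addrC; apply: le_trans (ler_normD _ _) _.
  have : `|f x - f x'| < e / 2 by apply: f_near => /=; lra.
  have : `|f x - f y| < e / 2.
    by apply: f_near => /=; rewrite -(subrKA x'); apply: le_lt_trans (ler_normD _ _) _; lra.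
  by rewrite [`|f x' - f x|]distrC; lra.
move=> osc; near (0 : R)^'+ => r; exists r; first by near: r; exact: nbhs_right_gt.
move=> x y x_itv; have : `[a, b]%classic `<=` small_osc r by near: r.
by apply; rewrite /= in_itv.
Unshelve. all: by end_near. Qed.

Lemma segment_mesh_ind (P : R -> R -> Prop) r s t : 0 < r -> s < t ->
  (forall a b, s <= a -> a < b -> b <= t -> b - a < r -> P a b) ->
  (forall a b c, s <= a -> a < b -> b < c -> c <= t -> P a b -> P b c -> P a c) -> P s t.
Proof.
move=> r_gt0 st P_mesh P_cat; pose K := (Num.truncn ((t - s) / r)).+1.
pose h := (t - s) / K%:R; have h_gt0 : 0 < h by rewrite divr_gt0 ?subr_gt0 // ltr0n.
have h_lt : h < r by rewrite /h ltr_pdivrMr ?ltr0n // mulrC -ltr_pdivrMr // truncnS_gt.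
pose p (i : nat) := s + i%:R * h.
have pS i : p i.+1 = p i + h by rewrite /p -natr1 mulrDl mul1r addrA.
have p_ge i : s <= p i by rewrite lerDl mulr_ge0 // ltW.
have pK : p K = t by rewrite /p /h mulrC divfK ?pnatr_eq0 // addrC subrK.
have p_lt i : p i < p i.+1 by rewrite pS ltrDl.
have p_gt i : s < p i.+1 := le_lt_trans (p_ge i) (p_lt i).
have p_le i : (i <= K)%N -> p i <= t.
  by move=> iK; rewrite -pK lerD2l ler_wpM2r ?ler_nat // ltW.
have step i : (i < K)%N -> P (p i) (p i.+1).
  by move=> iK; apply: P_mesh; rewrite ?p_ge ?p_lt ?p_le // pS addrC addKr.
have p0 : p 0%N = s by rewrite /p mul0r addr0.
suff chain i : (i < K)%N -> P s (p i.+1) by rewrite -pK; exact: chain.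
elim: i => [|i IH] iK; first by rewrite -p0; exact: step.
by apply: P_cat (IH (ltnW iK)) (step _ iK); rewrite ?p_le.
Qed.

Lemma itv_oc_setU a b c : a <= b -> b <= c ->
  `]a, c]%classic = `]a, b] `|` `]b, c] :> set R.
Proof. by move=> ab bc; rewrite -itv_bndbnd_setU // bnd_simp. Qed.

Lemma itv_oc_setI a b c : `]a, b]%classic `&` `]b, c]%classic = set0.
Proof.
apply/seteqP; split => // x [] /=; rewrite !in_itv /= => /andP[_ xb] /andP[bx _].
by have := lt_le_trans bx xb; rewrite ltxx.
Qed.

Definition mass_itv m s t : R := fine (m `]s, t]%classic).

Lemma mass_itv_cat m a b c : a <= b -> b <= c ->
  mass_itv m a c = mass_itv m a b + mass_itv m b c.
Proof.
move=> ab bc; rewrite /mass_itv (itv_oc_setU ab bc) measureU //; last exact: itv_oc_setI.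
by rewrite fineD ?fin_num_measure.
Qed.

Lemma mass_itv_le1 m a b : mass_itv m a b <= 1.
Proof. by rewrite -lee_fin fineK ?fin_num_measure //; exact: probability_le1. Qed.

Lemma integrable_continuous_bounded m f (A : set R) : continuous f ->
  (exists M : R, forall t, `|f t| <= M) -> measurable A -> m.-integrable A (EFin \o f).
Proof.
move=> f_cont [M fM] mA; apply: measurable_bounded_integrable => //.
- by rewrite (le_lt_trans (probability_le1 _ _)) ?ltry.
- by apply: measurable_funTS; exact: continuous_measurable_fun.
- exists M; split; first exact: num_real.
  by move=> N MN x _ /=; exact: le_trans (fM x) (ltW MN).
Qed.

Lemma integrable_cst m (A : set R) c : measurable A -> m.-integrable A (EFin \o cst c).
Proof.
by apply: integrable_continuous_bounded; [exact: cst_continuous|exists `|c|].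
Qed.

Lemma Rintegral_itv_cat m f a b c : continuous f -> (exists M : R, forall t, `|f t| <= M) ->
  a <= b -> b <= c ->
  \int[m]_(x in `]a, c]) f x = \int[m]_(x in `]a, b]) f x + \int[m]_(x in `]b, c]) f x.
Proof.
move=> f_cont f_bnd ab bc; rewrite (itv_oc_setU ab bc) Rintegral_setU //.
  by apply: integrable_continuous_bounded => //; exact: measurableU.
exact/disj_set2P/itv_oc_setI.
Qed.

Lemma Rintegral_setC_itv m f a b : continuous f -> (exists M : R, forall t, `|f t| <= M) ->
  \int[m]_x f x = \int[m]_(x in `]a, b]) f x + \int[m]_(x in ~` `]a, b]) f x.
Proof.
move=> f_cont f_bnd; rewrite -{1}(setUv `]a, b]) Rintegral_setU //.
- exact: measurableC.
- by apply: integrable_continuous_bounded => //; rewrite setUv.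
- exact/disj_setPCl.
Qed.

Lemma Rintegral_itv_le m f a b : continuous f -> (exists M : R, forall t, `|f t| <= M) ->
  (forall t, 0 <= f t) -> \int[m]_(x in `]a, b]) f x <= \int[m]_x f x.
Proof.
move=> f_cont f_bnd f_ge0; rewrite (Rintegral_setC_itv m a b f_cont f_bnd) lerDl.
exact: Rintegral_ge0.
Qed.

Lemma Rintegral_le_itv m f a b M : continuous f -> (forall t, `|f t| <= M) ->
  \int[m]_x f x <= \int[m]_(x in `]a, b]) f x + M * (1 - mass_itv m a b).
Proof.
move=> f_cont fM; have f_bnd : exists M, forall t, `|f t| <= M by exists M.
have mC : measurable (~` `]a, b]%classic : set R) by exact: measurableC.
have -> : 1 - mass_itv m a b = fine (m (~` `]a, b]%classic)).
  by rewrite probability_setC // fineB ?fin_num_measure.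
rewrite (Rintegral_setC_itv m a b f_cont f_bnd) lerD2l -Rintegral_cst //.
apply: le_Rintegral => //.
- exact: integrable_continuous_bounded.
- exact: integrable_cst.
- by move=> x _; exact: le_trans (ler_norm _) (fM x).
Qed.

End real_line.

Section weak_convergence.
Context {R : realType}.
Variables (mu_ : nat -> probability R R) (m : probability R R) (D : set R).
Hypothesis D_itv : is_interval D.
Hypothesis mass_itv_lower : forall s t e : R, D s -> D t -> s < t -> 0 < e ->
  \forall n \near \oo, mass_itv m s t - e <= mass_itv (mu_ n) s t.
Hypothesis tight : forall e : R, 0 < e ->
  exists s t : R, [/\ D s, D t, s < t & 1 - e <= mass_itv m s t].

Section nonnegative.
Variables (f : R -> R) (M : R).
Hypotheses (f_cont : continuous f) (f_ge0 : forall t, 0 <= f t) (fM : forall t, `|f t| <= M).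
Implicit Types a b c d e : R.

Let f_bnd : exists N : R, forall t, `|f t| <= N. Proof. by exists M. Qed.

Definition Rintegral_itv_lower e a b := forall d, 0 < d -> \forall n \near \oo,
  \int[m]_(x in `]a, b]) f x - e * mass_itv m a b - d <= \int[mu_ n]_(x in `]a, b]) f x.

Lemma Rintegral_itv_lower_osc e a b : D a -> D b -> a < b -> 0 < e ->
  (forall x, a < x <= b -> `|f b - f x| <= e / 2) -> Rintegral_itv_lower e a b.
Proof.
move=> Da Db ab e_gt0 osc d d_gt0; pose c := Num.max 0 (f b - e / 2).
have c_ge0 : 0 <= c by rewrite le_max lexx.
have lower n : c * mass_itv (mu_ n) a b <= \int[mu_ n]_(x in `]a, b]) f x.
  rewrite -Rintegral_cst //; apply: le_Rintegral => //.
  - exact: integrable_cst.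
  - exact: integrable_continuous_bounded.
  - move=> x; rewrite /= in_itv /= => /osc; rewrite ler_norml => /andP[_ ?].
    by rewrite ge_max f_ge0 /=; lra.
have upper : \int[m]_(x in `]a, b]) f x <= (c + e) * mass_itv m a b.
  rewrite -Rintegral_cst //; apply: le_Rintegral => //.
  - exact: integrable_continuous_bounded.
  - exact: integrable_cst.
  - move=> x; rewrite /= in_itv /= => /osc; rewrite ler_norml => /andP[? _].
    by have : f b - e / 2 <= c; [rewrite le_max lexx orbT|rewrite /cst; lra].
have dc_gt0 : 0 < d / (c + 1) by rewrite divr_gt0 // ltr_wpDl.
near=> n; apply: le_trans (lower n).
have : mass_itv m a b - d / (c + 1) <= mass_itv (mu_ n) a b.
  by near: n; exact: mass_itv_lower.
move=> /(ler_wpM2l c_ge0); have : c * (d / (c + 1)) <= d.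
  by rewrite mulrCA ger_pMr // ler_pdivrMr ?ltr_wpDl // mul1r lerDl.
by move: upper; rewrite mulrDl mulrBr; lra.
Unshelve. all: by end_near. Qed.

Lemma Rintegral_itv_lower_cat e a b c : a <= b -> b <= c ->
  Rintegral_itv_lower e a b -> Rintegral_itv_lower e b c -> Rintegral_itv_lower e a c.
Proof.
move=> ab bc low_ab low_bc d d_gt0; have d2_gt0 : 0 < d / 2 by rewrite divr_gt0.
apply: filterS2 (low_ab _ d2_gt0) (low_bc _ d2_gt0) => n.
rewrite (mass_itv_cat m ab bc) !(Rintegral_itv_cat _ f_cont f_bnd ab bc).
by rewrite mulrDr; lra.
Qed.

Lemma Rintegral_itv_lower_segment e a b : D a -> D b -> a < b -> 0 < e ->
  Rintegral_itv_lower e a b.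
Proof.
move=> Da Db ab e_gt0; have e2_gt0 : 0 < e / 2 by rewrite divr_gt0.
have [r r_gt0 osc] := @uniform_continuity_segment _ f a b _ f_cont e2_gt0.
have D_seg x : a <= x -> x <= b -> D x by move=> ax xb; apply: (D_itv Da Db); rewrite ax.
apply: (segment_mesh_ind r_gt0 ab) => [s t a_s st tb st_lt|s t t' _ st tt' _].
  apply: Rintegral_itv_lower_osc => //.
  - exact: D_seg a_s (le_trans (ltW st) tb).
  - exact: D_seg (le_trans a_s (ltW st)) tb.
  - move=> x /andP[sx xt]; apply: osc; first by rewrite tb (le_trans a_s) // ltW.
    by rewrite ger0_norm ?subr_ge0 //; lra.
by apply: Rintegral_itv_lower_cat; exact: ltW.
Qed.

Lemma Rintegral_lower e : 0 < e ->
  \forall n \near \oo, \int[m]_x f x - e <= \int[mu_ n]_x f x.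
Proof.
move=> e_gt0; have M_ge0 : 0 <= M := le_trans (normr_ge0 _) (fM 0).
have e3_gt0 : 0 < e / 3 by rewrite divr_gt0.
have eM_gt0 : 0 < e / 3 / (M + 1) by rewrite divr_gt0 // ltr_wpDl.
have [a [b [Da Db ab mass_ge]]] := tight eM_gt0.
have tail : M * (1 - mass_itv m a b) <= e / 3.
  apply: (@le_trans _ _ (M * (e / 3 / (M + 1)))); first by rewrite ler_wpM2l //; lra.
  by rewrite mulrCA ger_pMr // ler_pdivrMr ?ltr_wpDl // mul1r lerDl.
have e_mass : e / 3 * mass_itv m a b <= e / 3.
  by rewrite ger_pMr //; exact: mass_itv_le1.
near=> n; apply: le_trans (Rintegral_itv_le (mu_ n) a b f_cont f_bnd f_ge0).
have : \int[m]_(x in `]a, b]) f x - e / 3 * mass_itv m a b - e / 3 <=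
    \int[mu_ n]_(x in `]a, b]) f x.
  by near: n; exact: Rintegral_itv_lower_segment.
by have := Rintegral_le_itv m a b f_cont fM; lra.
Unshelve. all: by end_near. Qed.

End nonnegative.

Lemma Rintegral_lower_bounded (f : R -> R) (e : R) : continuous f ->
  (exists M : R, forall t, `|f t| <= M) -> 0 < e ->
  \forall n \near \oo, \int[m]_x f x - e <= \int[mu_ n]_x f x.
Proof.
move=> f_cont [M fM] e_gt0; have f_itv t : - M <= f t <= M by rewrite -ler_norml.
have f_int (q : probability R R) : q.-integrable setT (EFin \o f).
  by apply: integrable_continuous_bounded => //; exists M.
have shift (q : probability R R) : \int[q]_t (M + f t) = M + \int[q]_t f t.
  rewrite (RintegralD _ (integrable_cst q M _) (f_int q)) // Rintegral_cst //.
  by rewrite [fine _](congr1 fine (probability_setT q)) mulr1.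
have : \forall n \near \oo, \int[m]_t (M + f t) - e <= \int[mu_ n]_t (M + f t).
  apply: (@Rintegral_lower _ (2 * M)) => //.
  - by move=> t; apply: cvgD; [exact: cvg_cst|exact: f_cont].
  - by move=> t; have /andP[] := f_itv t; lra.
  - by move=> t; rewrite ger0_norm; have /andP[] := f_itv t; lra.
by apply: filterS => n; rewrite !shift -addrA lerD2l.
Qed.

(* Lower bounds suffice: applied to [f] and to [- f] they give both inequalities. *)
Lemma weakly_converges_mass_itv_lower : weakly_converges mu_ m.
Proof.
move=> f f_cont f_bnd.
have f_int (q : probability R R) : q.-integrable setT (EFin \o f).
  exact: integrable_continuous_bounded.
have RintegralE (q : probability R R) : (\int[q]_t (f t)%:E = (\int[q]_t f t)%R%:E)%E.
  by rewrite /Rintegral fineK //; exact: integrable_fin_num (f_int q).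
have RintegralNE (q : probability R R) : \int[q]_t (- f t) = - \int[q]_t f t.
  by under eq_Rintegral do rewrite -mulN1r; rewrite (RintegralZl _ _ (f_int q)) ?mulN1r.
have fN_cont : continuous (fun t => - f t) by move=> t; apply: cvgN; exact: f_cont.
have fN_bnd : exists M : R, forall t, `|- f t| <= M.
  by have [M fM] := f_bnd; exists M => t; rewrite normrN.
under eq_fun do rewrite RintegralE.
rewrite RintegralE; apply: cvg_EFin; first exact: nearW.
apply/cvgrPdist_le => e e_gt0.
apply: filterS2 (Rintegral_lower_bounded f_cont f_bnd e_gt0)
  (Rintegral_lower_bounded fN_cont fN_bnd e_gt0) => n.
by rewrite !RintegralNE /= ler_norml => ? ?; apply/andP; split; lra.
Qed.

End weak_convergence.

(** * The limit law *)

Section density_measure.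
Context d (T : measurableType d) (R : realType).
Variables (nu : {measure set T -> \bar R}) (f : T -> R).
Hypotheses (mf : measurable_fun setT f) (f_ge0 : forall x, 0 <= f x).

Definition density_measure (A : set T) : \bar R := (\int[nu]_(x in A) (f x)%:E)%E.

Let density0 : density_measure set0 = 0%E.
Proof. exact: integral_set0. Qed.

Let density_ge0 A : (0 <= density_measure A)%E.
Proof. by apply: integral_ge0 => x _; rewrite lee_fin. Qed.

Let density_sigma_additive : semi_sigma_additive density_measure.
Proof.
move=> /= F mF tF mUF; apply: cvg_toP.
  apply: ereal_nondecreasing_is_cvgn => m n mn.
  by apply: lee_sum_nneg_natr => // k _ _; exact: density_ge0.
rewrite /density_measure ge0_integral_bigcup//=.
- by apply/measurable_EFinP; exact: measurable_funTS.
- by move=> x _; rewrite lee_fin.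
Qed.

HB.instance Definition _ := isMeasure.Build _ _ _
  density_measure density0 density_ge0 density_sigma_additive.

End density_measure.

Section densities.
Context {R : realType}.
Local Notation leb := (@lebesgue_measure R).
Implicit Types (f F : R -> R) (a b s t x : R).

Lemma lebesgue_stieltjes_measure_itv_oc (F : cumulative R R) a b : a <= b ->
  lebesgue_stieltjes_measure F `]a, b]%classic = (F b - F a)%:E.
Proof.
move=> ab; rewrite /lebesgue_stieltjes_measure /measure_extension/=.
by rewrite measurable_mu_extE/= ?wlength_itv_bnd//; exact: is_ocitv.
Qed.

Lemma integral_itv_oc_derive f F a b : a < b -> measurable_fun setT f ->
  {in `[a, b], forall x, {for x, continuous f} /\ is_derive x 1 F (f x)} ->
  (\int[leb]_(x in `]a, b]) (f x)%:E = (F b - F a)%:E)%E.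
Proof.
move=> ab mf fF; rewrite integral_itv_obnd_cbnd; last first.
  by apply/measurable_EFinP; exact: measurable_funTS.
have F_derivable x : x \in `[a, b] -> derivable F x 1 by move=> /fF[_ []].
have F_cont x : x \in `[a, b] -> {for x, continuous F}.
  by move=> /F_derivable ?; apply: differentiable_continuous; exact/derivable1_diffP.
rewrite EFinB; apply: continuous_FTC2 => //.
- by apply: continuous_in_subspaceT => x; rewrite inE => /fF[].
- split.
  + by move=> x /subset_itv_oo_cc /F_derivable.
  + by apply: cvg_at_right_filter; apply: F_cont; rewrite in_itv /= lexx ltW.
  + by apply: cvg_at_left_filter; apply: F_cont; rewrite in_itv /= lexx ltW.
- by move=> x /subset_itv_oo_cc /fF[_ [_]]; rewrite derive1E.
Qed.

Lemma is_derive_cauchy_cdf x : is_derive x 1 cauchy_cdf (standard_cauchy_pdf x).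
Proof.
have -> : @cauchy_cdf R = cst 2^-1 + pi^-1 \*: @atan R.
  by apply/funext => y; rewrite /cauchy_cdf fctE [_ / pi]mulrC.
rewrite -[standard_cauchy_pdf x]add0r /standard_cauchy_pdf invfM.
exact: (is_deriveD (is_derive_cst _ _ _) (is_deriveZ _ (is_derive1_atan x))).
Qed.

Lemma continuous_cauchy_pdf : continuous (@standard_cauchy_pdf R).
Proof.
move=> x; apply: cvgV; first by rewrite gt_eqF // mulr_gt0 ?pi_gt0 // ltr_wpDr ?sqr_ge0.
apply: cvgM; first exact: cvg_cst.
by apply: cvgD; [exact: cvg_cst|exact: exprn_continuous].
Qed.

Lemma integral_cauchy_pdf a b : a < b ->
  (\int[leb]_(x in `]a, b]) (standard_cauchy_pdf x)%:E = (cauchy_cdf b - cauchy_cdf a)%:E)%E.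
Proof.
move=> ab; apply: integral_itv_oc_derive => //.
  exact: continuous_measurable_fun continuous_cauchy_pdf.
by move=> x _; split; [exact: continuous_cauchy_pdf|exact: is_derive_cauchy_cdf].
Qed.

Definition eulerian_density t : R :=
  if 0 < t then (t * (ln t ^+ 2 + pi ^+ 2))^-1 else 0.

Definition eulerian_cdf t : R := cauchy_cdf (ln t / pi).

Lemma eulerian_density_den_gt0 t : 0 < t -> 0 < t * (ln t ^+ 2 + pi ^+ 2).
Proof. by move=> t_gt0; rewrite mulr_gt0 // ltr_wpDl ?sqr_ge0 // exprn_gt0 // pi_gt0. Qed.

Lemma eulerian_density_ge0 t : 0 <= eulerian_density t.
Proof.
rewrite /eulerian_density; case: ifP => // t_gt0.
by rewrite invr_ge0 ltW // eulerian_density_den_gt0.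
Qed.

Lemma continuous_eulerian_density t : 0 < t -> {for t, continuous eulerian_density}.
Proof.
move=> t_gt0; have : (fun t => (t * (ln t ^+ 2 + pi ^+ 2))^-1) @ t --> eulerian_density t.
  rewrite /eulerian_density t_gt0; apply: cvgV.
    by rewrite gt_eqF // eulerian_density_den_gt0.
  apply: cvgM; first exact: cvg_id.
  apply: cvgD; last exact: cvg_cst.
  under eq_fun do rewrite expr2.
  by rewrite expr2; apply: cvgM; exact: continuous_ln.
apply: cvg_trans; apply: near_eq_cvg; near=> x.
have x_gt0 : 0 < x by near: x; exact: lt_nbhsr.
by rewrite /eulerian_density x_gt0.
Unshelve. all: by end_near. Qed.

Lemma eulerian_density_restrict : eulerian_density = eulerian_density \_ `]0, +oo[.
Proof.
apply/funext => t; rewrite patchE mem_setE in_itv /= andbT.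
by rewrite /eulerian_density; case: ifP.
Qed.

Lemma measurable_eulerian_density : measurable_fun setT eulerian_density.
Proof.
rewrite eulerian_density_restrict.
apply/(measurable_restrictT _ _).1 => //; apply: open_continuous_measurable_fun => //.
by move=> t; rewrite inE /= in_itv /= andbT; exact: continuous_eulerian_density.
Qed.

Lemma is_derive_eulerian_cdf t : 0 < t -> is_derive t 1 eulerian_cdf (eulerian_density t).
Proof.
move=> t_gt0; have ln_derive : is_derive t 1 (fun x => ln x / pi) (t^-1 / pi).
  have -> : (fun x => ln x / pi) = pi^-1 \*: (@ln R) by apply/funext => x; rewrite /= mulrC.
  by rewrite [_ / _]mulrC; apply: is_deriveZ; exact: is_derive1_ln.
have := @is_derive1_comp _ cauchy_cdf (fun x => ln x / pi) t _ _ (is_derive_cauchy_cdf _) ln_derive.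
suff -> : standard_cauchy_pdf (ln t / pi) * (t^-1 / pi) = eulerian_density t by [].
rewrite /eulerian_density t_gt0 /standard_cauchy_pdf.
have pi0 := @pi_gt0 R; have : 0 < ln t ^+ 2 + pi ^+ 2 by rewrite ltr_wpDl ?sqr_ge0 // exprn_gt0.
move: (pi : R) (ln t) pi0 => p l p_gt0 lp_gt0.
by field; rewrite !gt_eqF // addrC.
Qed.

Lemma integral_eulerian_density s t : 0 < s -> s < t ->
  (\int[leb]_(x in `]s, t]) (eulerian_density x)%:E = (eulerian_cdf t - eulerian_cdf s)%:E)%E.
Proof.
move=> s_gt0 st; apply: integral_itv_oc_derive => //; first exact: measurable_eulerian_density.
move=> x; rewrite in_itv /= => /andP[/(lt_le_trans s_gt0) x_gt0 _].
by split; [exact: continuous_eulerian_density|exact: is_derive_eulerian_cdf].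
Qed.

End densities.

Section cauchy_law.
Context {R : realType}.
Implicit Types (A : set R) (a b x : R).

Let cauchy_cdf_nondecreasing : nondecreasing_fun (@cauchy_cdf R).
Proof.
by move=> x y; rewrite le_eqVlt => /predU1P[-> //|xy]; rewrite ltW // lt_cauchy_cdf.
Qed.

Let cauchy_cdf_right_continuous : right_continuous (@cauchy_cdf R).
Proof.
move=> x; apply: cvg_at_right_filter; apply: differentiable_continuous.
by apply/derivable1_diffP; have [] := is_derive_cauchy_cdf x.
Qed.

Let pi_half_div : pi / 2 / pi = 2^-1 :> R.
Proof. by rewrite mulrAC divff ?mul1r // gt_eqF // pi_gt0. Qed.

Let cvg_cauchy_cdfy : @cauchy_cdf R x @[x --> +oo] --> (1 : R).
Proof.
have -> : 1 = 2^-1 + pi / 2 / pi :> R by rewrite pi_half_div; lra.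
apply: cvgD; first exact: cvg_cst.
by apply: cvgM; [exact: cvgy_atan|exact: cvg_cst].
Qed.

Let cvg_cauchy_cdfNy : @cauchy_cdf R x @[x --> -oo] --> (0 : R).
Proof.
have cdfN : @cauchy_cdf R \o -%R = fun x => 1 - cauchy_cdf x.
  by apply/funext => x; rewrite /cauchy_cdf /= atanN mulNr opprD addrA; congr (_ - _); lra.
have : 1 - cauchy_cdf x @[x --> +oo] --> (1 - 1 : R).
  by apply: cvgB; [exact: cvg_cst|exact: cvg_cauchy_cdfy].
by rewrite subrr cvgNy_compNP cdfN.
Qed.

HB.instance Definition _ := isCumulative.Build R _ R (@cauchy_cdf R)
  cauchy_cdf_nondecreasing cauchy_cdf_right_continuous.

HB.instance Definition _ := isCumulativeBounded.Build R 0 1 (@cauchy_cdf R)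
  cvg_cauchy_cdfNy cvg_cauchy_cdfy.

Definition cauchy_law : probability (measurableTypeR R) R :=
  lebesgue_stieltjes_measure (@cauchy_cdf R).

Lemma cauchy_law_unique (mu : {measure set (measurableTypeR R) -> \bar R}) :
  (forall a b, a < b -> mu `]a, b]%classic = (cauchy_cdf b - cauchy_cdf a)%:E) ->
  forall A, measurable A -> cauchy_law A = mu A.
Proof.
move=> mu_itv A mA; apply: lebesgue_stieltjes_measure_unique => // _ [[a b] _ <-] /=.
have [ab|ba] := ltP a b; last by rewrite set_itv_ge ?measure0 // bnd_simp -leNgt.
by rewrite mu_itv // -lebesgue_stieltjes_measure_itv_oc // ltW.
Qed.

Let idTR : measurableTypeR R -> R := idfun.

#[local] HB.instance Definition _ :=
  @isMeasurableFun.Build _ _ _ _ idTR (@measurable_id _ _ setT).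

Definition eulerian_law : probability R R := distribution cauchy_law (exp_pi idTR).

Lemma eulerian_lawE A : eulerian_law A = cauchy_law [set x | A (expR (pi * x))].
Proof. by []. Qed.

Lemma eulerian_law_exp_cauchy d (T : measurableType d) (P : probability T R)
    (Z : {RV P >-> R}) A :
  has_density (distribution P Z) (@standard_cauchy_pdf R) -> measurable A ->
  eulerian_law A = distribution P (exp_pi Z) A.
Proof.
move=> [_ _ Z_density] mA.
transitivity (distribution P Z (exp_pi idTR @^-1` A)); last by [].
apply: (cauchy_law_unique (mu := pushforward P (Z : T -> measurableTypeR R))).
- exact: (@measurable_funPT _ _ _ _ Z).
- by move=> ? a b ab; rewrite -integral_cauchy_pdf // -Z_density.
- exact: (measurable_funPTI (exp_pi idTR) mA).
Qed.

Let mu := density_measure (@lebesgue_measure R) (@eulerian_density R).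

Let mu_setI_pos A : mu A = mu (A `&` `]0, +oo[).
Proof.
rewrite /mu /density_measure [RHS]integral_mkcondr; apply: eq_integral => x _.
by rewrite [in LHS]eulerian_density_restrict !patchE; case: ifP.
Qed.

(* By uniqueness, the Cauchy law is the image of [mu] under the inverse [t |-> ln t / pi]. *)
Let cauchy_lawE A : measurable A -> cauchy_law A = mu [set t | A (ln t / pi)].
Proof.
apply: (cauchy_law_unique (mu := pushforward mu (fun t => ln t / pi : measurableTypeR R))).
- exact: measurable_eulerian_density.
- exact: eulerian_density_ge0.
- by move=> ? ?; apply: measurable_funM => //; exact: measurable_ln.
move=> ? ? ? a b ab; have pi0 := @pi_gt0 R.
rewrite [LHS](mu_setI_pos [set t | `]a, b]%classic (ln t / pi)]).
have lt_ln x t : 0 < t -> (x < ln t / pi) = (expR (pi * x) < t).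
  by move=> t_gt0; rewrite ltr_pdivlMr // [x * pi]mulrC -[in LHS]ltr_expR lnK ?posrE.
have -> : [set t | `]a, b]%classic (ln t / pi)] `&` `]0, +oo[ =
    `]expR (pi * a), expR (pi * b)]%classic.
  apply/seteqP; split => [t /= []|t /=]; rewrite !in_itv /= ?andbT.
    by move=> /[swap] t_gt0; rewrite !leNgt !lt_ln.
  move=> /[dup] /andP[/(lt_trans (expR_gt0 _)) t_gt0 _].
  by rewrite !leNgt !lt_ln.
rewrite /mu /density_measure integral_eulerian_density ?expR_gt0 //.
  by rewrite /eulerian_cdf !expRK ![pi * _]mulrC !mulfK // gt_eqF.
by rewrite ltr_expR ltr_pM2l.
Qed.

Lemma has_density_eulerian_law : has_density eulerian_law (@eulerian_density R).
Proof.
split; [exact: measurable_eulerian_density|exact: eulerian_density_ge0|move=> A mA].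
rewrite eulerian_lawE; transitivity (mu [set t | A (expR (pi * (ln t / pi)))]).
  by apply: cauchy_lawE; exact: (measurable_funPTI (exp_pi idTR) mA).
rewrite -[RHS]/(mu A) mu_setI_pos [RHS]mu_setI_pos; congr mu.
apply/seteqP; split => t /= [+ t_gt0]; move: (t_gt0); rewrite in_itv /= andbT => t_pos;
  by rewrite mulrC divfK ?gt_eqF ?pi_gt0 // lnK.
Qed.

End cauchy_law.

Section eulerian_law_theory.
Context {R : realType}.
Implicit Types (e p s t : R).

Lemma eulerian_cdf_itv t : 0 < eulerian_cdf t < 1.
Proof. exact: cauchy_cdf_itv. Qed.

Lemma lt_eulerian_cdf s t : 0 < s -> s < t -> eulerian_cdf s < eulerian_cdf t.
Proof.
move=> s_gt0 st; rewrite lt_cauchy_cdf // ltr_pM2r ?invr_gt0 ?pi_gt0 //.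
by rewrite ltr_ln ?posrE // (lt_trans s_gt0).
Qed.

Lemma eulerian_cdfK t : 0 < t -> eulerian_quantile (eulerian_cdf t) = t.
Proof.
move=> t_gt0; rewrite /eulerian_quantile cauchy_cdfK mulrC divfK ?lnK //.
by rewrite gt_eqF // pi_gt0.
Qed.

Lemma eulerian_quantileK p : 0 < p < 1 -> eulerian_cdf (eulerian_quantile p) = p.
Proof.
move=> p_itv; rewrite /eulerian_cdf expRK mulrAC divff ?mul1r ?cauchy_quantileK //.
by rewrite gt_eqF // pi_gt0.
Qed.

Lemma mass_itv_eulerian_law s t : 0 < s -> s < t ->
  mass_itv eulerian_law s t = eulerian_cdf t - eulerian_cdf s.
Proof.
move=> s_gt0 st; have [_ _ lawE] := @has_density_eulerian_law R.
by rewrite /mass_itv lawE // integral_eulerian_density.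
Qed.

Lemma eulerian_law_tight e : 0 < e ->
  exists s t, [/\ 0 < s, 0 < t, s < t & 1 - e <= mass_itv eulerian_law s t].
Proof.
move=> e_gt0; pose p := Num.min (e / 2) (1 / 4).
have p_gt0 : 0 < p by rewrite lt_min !divr_gt0.
have p_le : p <= 1 / 4 by rewrite ge_min lexx orbT.
have p_e : p <= e / 2 by rewrite ge_min lexx.
have q_lt : eulerian_quantile p < eulerian_quantile (1 - p).
  by apply: lt_eulerian_quantile => //; lra.
exists (eulerian_quantile p), (eulerian_quantile (1 - p)); split; rewrite ?expR_gt0 //.
rewrite mass_itv_eulerian_law ?expR_gt0 // !eulerian_quantileK; first lra.
all: by apply/andP; split; lra.
Qed.

Lemma eulerian_law_support : measure_support (@eulerian_law R) = [set t | 0 <= t].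
Proof.
apply/seteqP; split => [t t_supp|t /= t_ge0 U oU Ut].
  rewrite /= leNgt; apply/negP => t_lt0.
  have : (0 < eulerian_law (`]-oo, 0%R[%classic : set R))%E.
    by apply: t_supp; [exact: interval_open|rewrite /= in_itv].
  rewrite eulerian_lawE (_ : [set x | _] = set0) ?measure0 ?ltxx //.
  apply/seteqP; split => // x; rewrite /= in_itv /= ltNge => /negP; apply.
  exact: expR_ge0.
have [e /= e_gt0 eU] : nbhs t U by exact: open_nbhs_nbhs.
pose a := t + e / 4; pose b := t + e / 2.
have a_gt0 : 0 < a by rewrite ltr_wpDl // divr_gt0.
have ab : a < b by rewrite ltrD2l; lra.
apply: (@lt_le_trans _ _ (eulerian_law `]a, b]%classic)).
  have [_ _ ->] := @has_density_eulerian_law R => //.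
  by rewrite integral_eulerian_density // lte_fin subr_gt0 lt_eulerian_cdf.
apply: le_measure; rewrite ?inE //; first exact: open_measurable.
move=> x /=; rewrite in_itv /= => /andP[ax xb]; apply: eU => /=.
by rewrite ltr_norml; apply/andP; split; rewrite /a /b in ax xb; lra.
Qed.

Lemma root_measure_itv_oc (y : nat -> R) n (s t : R) :
  root_measure y n.+1 `]s, t]%classic =
  (n.+1%:R^-1 * #|[set k : 'I_n.+1 | s < - y k.+1 <= t]%SET|%:R)%:E.
Proof.
rewrite /root_measure /mscale /= /msum EFinM; congr (_ * _)%E.
rewrite (eq_bigr (fun k : 'I_n.+1 => ((s < - y k.+1 <= t)%R%:R : R)%:E)) => [|k _]; last first.
  by rewrite /= diracE mem_setE in_itv.
rewrite sumEFin -sum1_card natr_sum [in RHS]big_mkcond /=; congr (_%:E).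
by apply: eq_bigr => k _; rewrite inE; case: ifP.
Qed.

Lemma root_measure_mass_itv_ge (x : nat -> nat -> R) s t e :
  (forall n : nat, (1 <= n)%N -> eulerian_roots n (x n)) -> 0 < s -> s < t -> 0 < e ->
  \forall n \near \oo,
    mass_itv eulerian_law s t - e <= mass_itv (root_measure (x n.+1) n.+1) s t.
Proof.
move=> x_roots s_gt0 st e_gt0; have st_cdf := lt_eulerian_cdf s_gt0 st.
have /andP[s_cdf_gt0 _] := eulerian_cdf_itv s; have /andP[_ t_cdf_lt1] := eulerian_cdf_itv t.
near=> n; rewrite mass_itv_eulerian_law // /mass_itv /= root_measure_itv_oc /= mulrC ler_pdivlMr //.
have : n.+1%:R * (eulerian_cdf t - eulerian_cdf s) - 2 <=
    #|[set k : 'I_n.+1 | s < - x n.+1 k.+1 <= t]%SET|%:R.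
  near: n; apply: filterS (eulerian_root_count s_cdf_gt0 (ltW st_cdf) t_cdf_lt1) => n.
  by rewrite (eulerian_cdfK s_gt0) (eulerian_cdfK (lt_trans s_gt0 st)); apply; exact: x_roots.
apply: le_trans; rewrite mulrBl [_ * (_ - _)]mulrC lerD2l lerN2 mulrC -ler_pdivrMr //.
apply: (@le_trans _ _ n%:R); last by rewrite ler_nat.
by near: n; exact: nbhs_infty_ger.
Unshelve. all: by end_near. Qed.

End eulerian_law_theory.

Theorem theorem1 (R : realType) (x : nat -> nat -> R)
    (hx : forall n : nat, (1 <= n)%N -> eulerian_roots n (x n)) :
  exists mu : probability R R,
    [/\ weakly_converges (fun n : nat => root_measure (x n.+1) n.+1) mu,
        measure_support mu = [set t : R | 0 <= t],
        forall (d : measure_display) (T : measurableType d)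
          (P : probability T R) (Z : {RV P >-> R}),
          has_density (distribution P Z) (@standard_cauchy_pdf R) ->
          forall A : set R, measurable A ->
            mu A = distribution P (exp_pi Z) A
      & has_density mu (fun t : R =>
          if 0 < t then (t * (ln t ^+ 2 + pi ^+ 2))^-1 else 0)].
Proof.
exists eulerian_law; split.
- apply: (weakly_converges_mass_itv_lower (D := `]0, +oo[%classic)).
  + exact: interval_is_interval.
  + move=> s t e; rewrite /= !in_itv /= !andbT => s_gt0 _.
    exact: root_measure_mass_itv_ge.
  + move=> e /eulerian_law_tight[s [t [s_gt0 t_gt0 st mass_ge]]].
    by exists s, t; split; rewrite //= in_itv /= andbT.
- exact: eulerian_law_support.
- by move=> d T P Z Z_density A mA; exact: eulerian_law_exp_cauchy.
- exact: has_density_eulerian_law.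
Qed.
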